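(* Let $M$ be a connected Riemann surface and let $\varphi:M\to G_5(\mathbb{C}^n)$ be a harmonic map of finite uniton number and finite isotropy order, with first return map $\mathbf{c}$ of nilorder $3$ and second return map $\mathbf{e}$. Set $\alpha=\operatorname{Im}\mathbf{c}^2$. Then the bundle map $$\mathbf{G}=\mathbf{c}^2\circ\mathbf{e}\circ\mathbf{c}\circ\mathbf{e}|_\alpha:\alpha\to\alpha$$ is nilpotent, and so is zero.
   Context: $M$ is a connected Riemann surface (not necessarily compact), $z$ a local complex coordinate, $\partial_z,\partial_{\bar z}$ the ordinary (flat) derivatives in $\mathbb{C}^n$. A smooth map $\varphi:M\to G_k(\mathbb{C}^n)$ is identified with the rank-$k$ subbundle of $M\times\mathbb{C}^n$ with fibre $\varphi(z)$ at $z$. $\pi_\psi$ is orthogonal projection onto $\psi$, $\psi^\perp$ the orthogonal complement, $\Gamma(\cdot)$ the smooth sections. For mutually orthogonal subbundles $\psi,\chi$, the second fundamental form is $A'_{\psi,\chi}=\pi_\chi\circ\partial_z|_\psi:\psi\to\chi$ (a bundle map); $A'_\psi=A'_{\psi,\psi^\perp}$. Images and kernels of bundle maps are understood as extended to subbundles over the isolated points where the rank drops (''filling out zeros''). For $\varphi$ harmonic, $G'(\varphi)=\operatorname{Im}A'_\varphi$, $G^{(0)}(\varphi)=\varphi$, $G^{(i+1)}(\varphi)=G'(G^{(i)}(\varphi))$. The isotropy order of $\varphi$ is the greatest $r\in\{1,2,\ldots,\infty\}$ such that $\varphi\perp G^{(i)}(\varphi)$ for all $1\le i\le r$; then $G^{(i)}(\varphi)\perp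 G^{(j)}(\varphi)$ whenever $1\le|i-j|\le r$. For $\varphi$ of finite isotropy order $r$, put $R=\bigl(\sum_{i=0}^rG^{(i)}(\varphi)\bigr)^\perp$. The first return map is the bundle map $\varphi\to\varphi$ $$\mathbf{c}=A'_{G^{(r)}(\varphi),\varphi}\circ A'_{G^{(r-1)}(\varphi)}\circ\cdots\circ A'_{G^{(1)}(\varphi)}\circ A'_\varphi,$$ and the second return map is the bundle map $\varphi\to\varphi$ $$\mathbf{e}=A'_{R,\varphi}\circ A'_{G^{(r)}(\varphi),R}\circ A'_{G^{(r-1)}(\varphi)}\circ\cdots\circ A'_{G^{(1)}(\varphi)}\circ A'_\varphi .$$ These are defined on each coordinate chart; a change of coordinate multiplies them by nowhere-zero functions. The nilorder of $\mathbf{c}$ is the least $p$ with $\mathbf{c}^p=0$. Finite uniton number: for smooth $\varphi:M\to U(n)$ put $A^\varphi_z=\frac12\varphi^{-1}\partial_z\varphi$, $A^\varphi_{\bar z}=\frac12\varphi^{-1}\partial_{\bar z}\varphi$. A uniton for a harmonic $\varphi:M\to U(n)$ is a subbundle $\alpha$ of $M\times\mathbb{C}^n$ with $\Gamma(\alpha)$ closed under $\partial_{\bar z}+A^\varphi_{\bar z}$ and under $A^\varphi_z$. $\varphi$ is of finite uniton number if $\varphi=\varphi_0(\pi_{\alpha_1}-\pi_{\alpha_1}^\perp)\cdots(\pi_{\alpha_s}-\pi_{\alpha_s}^\perp)$ for some $s\ge0$, with $\varphi_0\in U(n)$ constant and each $\alpha_i$ a uniton for the partial product of the first $i-1$ factors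 (times $\varphi_0$). A map $\varphi:M\to G_k(\mathbb{C}^n)$ is of finite uniton number if $\pi_\varphi-\pi_\varphi^\perp:M\to U(n)$ is. *)

(* Defs.v *)
From mathcomp Require Import all_boot all_order all_algebra.
From mathcomp Require Import all_classical all_reals all_analysis.
From mathcomp Require Import complex ring.

Set Implicit Arguments.
Unset Strict Implicit.
Unset Printing Implicit Defensive.

Import Order.TTheory GRing.Theory Num.Theory numFieldNormedType.Exports.
Local Open Scope classical_set_scope.
Local Open Scope ring_scope.
Local Open Scope sesquilinear_scope.

(* Riemann surfaces, given by an atlas of holomorphically compatible
   coordinates z : U -> C.  R[i] carries its topology under the alias R[i]^o,
   as a normed module over itself; [derivable _ w 1] over the scalar field R[i]
   is therefore complex differentiability at w.  The atlas is an arbitrary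
   one, so quantifying over its charts loses no local coordinate. *)
Record riemannSurface (R : realType) := RiemannSurface {
  surface :> topologicalType ;
  surface_hausdorff : hausdorff_space surface ;
  chart : Type ;
  chart_dom : chart -> set surface ;
  chart_img : chart -> set R[i]^o ;
  coord : chart -> surface -> R[i]^o ;
  param : chart -> R[i]^o -> surface ;
  chart_dom_open : forall c, open (chart_dom c) ;
  chart_img_open : forall c, open (chart_img c) ;
  coord_img : forall c p, chart_dom c p -> chart_img c (coord c p) ;
  param_dom : forall c w, chart_img c w -> chart_dom c (param c w) ;
  coordK : forall c p, chart_dom c p -> param c (coord c p) = p ;
  paramK : forall c w, chart_img c w -> coord c (param c w) = w ;
  coord_continuous :
    forall c p, chart_dom c p -> {for p, continuous (coord c)} ;
  param_continuous :
    forall c w, chart_img c w -> {for w, continuous (param c)} ;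
  chart_cover : forall p, exists c, chart_dom c p ;
  transition_holomorphic : forall c d w,
    chart_img c w -> chart_dom d (param c w) ->
    derivable (coord d \o param c : R[i]^o -> R[i]^o) w (1 : R[i]^o)
}.

Section Calculus.
Context {R : realType}.
Local Notation C := (R[i]).

(* real derivatives of f : C -> C at w in the direction v *)
Definition dir_derivable (v : C) (f : C -> C) (w : C) : Prop :=
  derivable (fun t : R => complex.Re (f (w + t%:C%C * v))) 0 1 /\
  derivable (fun t : R => complex.Im (f (w + t%:C%C * v))) 0 1.

Definition dir_derive (v : C) (f : C -> C) (w : C) : C :=
  (derive1 (fun t : R => complex.Re (f (w + t%:C%C * v))) 0
   +i* derive1 (fun t : R => complex.Im (f (w + t%:C%C * v))) 0)%C.

Fixpoint Ck (k : nat) (U : set C^o) (f : C -> C) : Prop :=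
  (forall w, U w -> {for w, continuous (f : C^o -> C^o)}) /\
  if k is k'.+1 then
    [/\ forall w, U w -> dir_derivable 1 f w /\ dir_derivable 'i%C f w,
        Ck k' U (dir_derive 1 f) & Ck k' U (dir_derive 'i%C f)]
  else True.

Definition wirt_z (f : C -> C) (w : C) : C :=
  2^-1 * (dir_derive 1 f w - 'i%C * dir_derive 'i%C f w).

Definition wirt_zbar (f : C -> C) (w : C) : C :=
  2^-1 * (dir_derive 1 f w + 'i%C * dir_derive 'i%C f w).

Context {M : riemannSurface R}.

Definition smooth_on (c : chart M) m n (f : M -> 'M[C]_(m, n)) : Prop :=
  forall i j k, Ck k (chart_img c) (fun w => f (param c w) i j).

Definition smooth m n (f : M -> 'M[C]_(m, n)) : Prop :=
  forall c, smooth_on c f.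

Definition d_z (c : chart M) m n (f : M -> 'M[C]_(m, n)) (p : M) :
    'M[C]_(m, n) :=
  \matrix_(i, j) wirt_z (fun w => f (param c w) i j) (coord c p).

Definition d_zbar (c : chart M) m n (f : M -> 'M[C]_(m, n)) (p : M) :
    'M[C]_(m, n) :=
  \matrix_(i, j) wirt_zbar (fun w => f (param c w) i j) (coord c p).

End Calculus.

Section Bundles.
Context {R : realType} {M : riemannSurface R} {n : nat}.
Local Notation C := (R[i]).

(* C^n is the space of column vectors.  A subspace is represented by the
   matrix of the orthogonal projection onto it (of which it is the column
   space), hence a subbundle psi by the matrix function p |-> pi_psi(p). *)
Definition orthoprojector (P : 'M[C]_n) : Prop :=
  P ^t* = P /\ P *m P = P.

Definition grassmannian (k : nat) : set 'M[C]_n :=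
  [set P | orthoprojector P /\ \rank P = k].

Definition subbundle (psi : M -> 'M[C]_n) : Prop :=
  smooth psi /\ forall p, orthoprojector (psi p).

Definition perp (psi : M -> 'M[C]_n) (p : M) : 'M[C]_n := 1%:M - psi p.

Definition orthogonal_bundles (psi chi : M -> 'M[C]_n) : Prop :=
  forall p, chi p *m psi p = 0.

(* A bundle map psi -> chi, depending on the coordinate, is represented by the
   endomorphism of C^n which extends it by 0 on psi^perp; only its values at
   the points of the domain of the chart are meaningful. *)
Definition bundle_map := chart M -> M -> 'M[C]_n.

Definition vanishes (A : bundle_map) : Prop :=
  forall c p, chart_dom c p -> A c p = 0.

Definition nilpotent_map (A : bundle_map) : Prop :=
  exists m, vanishes (fun c p => A c p ^+ m).

Definition nilorder (A : bundle_map) (m : nat) : Prop :=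
  vanishes (fun c p => A c p ^+ m) /\
  forall m', vanishes (fun c p => A c p ^+ m') -> (m <= m')%N.

(* beta is the image of A with zeros filled out: a smooth subbundle which
   agrees with Im A away from isolated points. *)
Definition filled_image (A : bundle_map) (beta : M -> 'M[C]_n) : Prop :=
  subbundle beta /\
  forall p : M, \forall q \near p^',
    forall c, chart_dom c q -> ((A c q)^T :=: (beta q)^T)%MS.

(* A'_{psi,chi}: v |-> pi_chi d_z s for any section s of psi through v; the
   section s = pi_psi v gives the formula (see sff_section below). *)
Definition sff (psi chi : M -> 'M[C]_n) : bundle_map :=
  fun c p => chi p *m d_z c psi p *m psi p.

Definition sff_perp (psi : M -> 'M[C]_n) : bundle_map := sff psi (perp psi).

(* A_z and A_zbar for maps into U(n) *)
Definition A_z (phi : M -> 'M[C]_n) : bundle_map :=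
  fun c p => 2^-1 *: (invmx (phi p) *m d_z c phi p).

Definition A_zbar (phi : M -> 'M[C]_n) : bundle_map :=
  fun c p => 2^-1 *: (invmx (phi p) *m d_zbar c phi p).

(* Harmonicity into U(n) with its bi-invariant metric: the Euler-Lagrange
   equation of the energy, d^* (phi^-1 d phi) = 0, in a coordinate. *)
Definition harmonic_U (phi : M -> 'M[C]_n) : Prop :=
  [/\ smooth phi, forall p, phi p \is unitarymx &
      vanishes (fun c p => d_zbar c (A_z phi c) p + d_z c (A_zbar phi c) p)].

(* pi_phi - pi_phi^perp; the Cartan embedding of the Grassmannian in U(n) is
   totally geodesic, so that it detects harmonicity. *)
Definition cartan (phi : M -> 'M[C]_n) (p : M) : 'M[C]_n :=
  phi p - perp phi p.

Definition harmonic_Gr (k : nat) (phi : M -> 'M[C]_n) : Prop :=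
  [/\ smooth phi, forall p, grassmannian k (phi p) & harmonic_U (cartan phi)].

Definition uniton (phi alpha : M -> 'M[C]_n) : Prop :=
  [/\ harmonic_U phi, subbundle alpha &
   forall (c : chart M) (s : M -> 'cV[C]_n),
     smooth_on c s ->
     (forall p, chart_dom c p -> alpha p *m s p = s p) ->
     forall p, chart_dom c p ->
       let t1 := d_zbar c s p + A_zbar phi c p *m s p in
       let t2 := A_z phi c p *m s p in
       alpha p *m t1 = t1 /\ alpha p *m t2 = t2].

Fixpoint uniton_product (phi0 : 'M[C]_n) (alpha : nat -> M -> 'M[C]_n)
    (i : nat) (p : M) : 'M[C]_n :=
  if i is i'.+1 then uniton_product phi0 alpha i' p *m cartan (alpha i') p
  else phi0.

Definition finite_uniton_number (phi : M -> 'M[C]_n) : Prop :=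
  exists (s : nat) (phi0 : 'M[C]_n) (alpha : nat -> M -> 'M[C]_n),
    [/\ phi0 \is unitarymx,
        forall i, (i < s)%N ->
          uniton (uniton_product phi0 alpha i) (alpha i) &
        forall p, phi p = uniton_product phi0 alpha s p].

(* G i = G^(i)(phi) for all i *)
Definition gauss_sequence (phi : M -> 'M[C]_n) (G : nat -> M -> 'M[C]_n) :
    Prop :=
  G 0%N = phi /\ forall i, filled_image (sff_perp (G i)) (G i.+1).

Definition isotropic_upto (G : nat -> M -> 'M[C]_n) (r : nat) : Prop :=
  forall i, (1 <= i <= r)%N -> orthogonal_bundles (G 0%N) (G i).

(* finite isotropy order r of phi = G 0 *)
Definition isotropy_order (G : nat -> M -> 'M[C]_n) (r : nat) : Prop :=
  [/\ (1 <= r)%N, isotropic_upto G r &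
      forall r', isotropic_upto G r' -> (r' <= r)%N].

(* R = (sum_(i <= r) G^(i))^perp.  When r is the isotropy order the G^(i),
   i <= r, are mutually orthogonal, and the projection onto their sum is the
   sum of the projections. *)
Definition remainder (G : nat -> M -> 'M[C]_n) (r : nat) (p : M) :
    'M[C]_n :=
  1%:M - \sum_(i < r.+1) G i p.

(* A'_{G^(i-1)} o ... o A'_{G^(0)} *)
Fixpoint sff_chain (G : nat -> M -> 'M[C]_n) (i : nat) : bundle_map :=
  fun c p =>
    if i is i'.+1 then sff_perp (G i') c p *m sff_chain G i' c p else G 0%N p.

Definition first_return (G : nat -> M -> 'M[C]_n) (r : nat) : bundle_map :=
  fun c p => sff (G r) (G 0%N) c p *m sff_chain G r c p.

Definition second_return (G : nat -> M -> 'M[C]_n) (r : nat) : bundle_map :=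
  fun c p => sff (remainder G r) (G 0%N) c p *m
             sff (G r) (remainder G r) c p *m sff_chain G r c p.

(* c^2 o e o c o e restricted to alpha *)
Definition return_cycle (G : nat -> M -> 'M[C]_n) (r : nat)
    (alpha : M -> 'M[C]_n) : bundle_map :=
  fun c p => let C1 := first_return G r c p in
             let E := second_return G r c p in
             C1 ^+ 2 *m E *m C1 *m E *m alpha p.

End Bundles.

Section SecondFundamentalForm.
Context {R : realType}.
Local Notation C := (R[i]).

(* f has derivative l at w in the direction v *)
Definition is_dir (v : C) (f : C -> C) (w l : C) : Prop :=
  is_derive (0 : R) (1 : R) (fun t : R => complex.Re (f (w + t%:C%C * v)))
    (complex.Re l) /\
  is_derive (0 : R) (1 : R) (fun t : R => complex.Im (f (w + t%:C%C * v)))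
    (complex.Im l).

Lemma is_dirP v f w : dir_derivable v f w -> is_dir v f w (dir_derive v f w).
Proof.
by move=> [a b]; split; rewrite /= derive1E; exact: derivableP.
Qed.

Lemma is_dirE v f w l : is_dir v f w l -> dir_derive v f w = l.
Proof.
by move=> [[_ a] [_ b]]; rewrite /dir_derive !derive1E a b; case: l {a b}.
Qed.

Lemma is_dirM v f g w a b : is_dir v f w a -> is_dir v g w b ->
  is_dir v (fun z => f z * g z) w (a * g w + f w * b).
Proof.
move=> [fr fi] [gr gi].
have w0 : w + (0 : R)%:C%C * v = w by rewrite rmorph0 mul0r addr0.
split.
- have -> : (fun t : R => complex.Re (f (w + t%:C%C * v) * g (w + t%:C%C * v)))
    = (fun t : R => complex.Re (f (w + t%:C%C * v))) *
      (fun t : R => complex.Re (g (w + t%:C%C * v))) -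
      (fun t : R => complex.Im (f (w + t%:C%C * v))) *
      (fun t : R => complex.Im (g (w + t%:C%C * v))).
    by apply/funext => t; rewrite !fctE; case: (f _) => ? ?; case: (g _).
  apply: is_derive_eq; rewrite w0.
  by case: (f w) (g w) a b {fr fi gr gi} => [? ?] [? ?] [? ?] [? ?] /=;
    rewrite /GRing.scale /=; ring.
- have -> : (fun t : R => complex.Im (f (w + t%:C%C * v) * g (w + t%:C%C * v)))
    = (fun t : R => complex.Re (f (w + t%:C%C * v))) *
      (fun t : R => complex.Im (g (w + t%:C%C * v))) +
      (fun t : R => complex.Im (f (w + t%:C%C * v))) *
      (fun t : R => complex.Re (g (w + t%:C%C * v))).
    by apply/funext => t; rewrite !fctE; case: (f _) => ? ?; case: (g _).
  apply: is_derive_eq; rewrite w0.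
  by case: (f w) (g w) a b {fr fi gr gi} => [? ?] [? ?] [? ?] [? ?] /=;
    rewrite /GRing.scale /=; ring.
Qed.

Lemma is_dir_sum v w k (f : 'I_k -> C -> C) (a : 'I_k -> C) :
  (forall i, is_dir v (f i) w (a i)) ->
  is_dir v (fun z => \sum_i f i z) w (\sum_i a i).
Proof.
move=> H; rewrite /is_dir.
have -> : (fun t : R => complex.Re (\sum_i f i (w + t%:C%C * v)))
    = \sum_i (fun t : R => complex.Re (f i (w + t%:C%C * v))).
  by apply/funext => t; rewrite fct_sumE (raddf_sum (@complex.Re R)).
have -> : (fun t : R => complex.Im (\sum_i f i (w + t%:C%C * v)))
    = \sum_i (fun t : R => complex.Im (f i (w + t%:C%C * v))).
  by apply/funext => t; rewrite fct_sumE (raddf_sum (@complex.Im R)).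
rewrite (raddf_sum (@complex.Re R)) (raddf_sum (@complex.Im R)).
by split; apply: is_derive_sum => i; have [h1 h2] := H i; first [exact: h1 | exact: h2].
Qed.

Lemma line_near (v w : C) (U : set C^o) : open U -> U w ->
  \forall t \near (0 : R), U (w + t%:C%C * v).
Proof.
move=> oU Uw; have /nbhs_ballP[e /= e0 sub] : nbhs (w : C^o) U.
  exact: open_nbhs_nbhs.
have [r r0 re] : exists2 r : R, 0 < r & e = r%:C%C.
  by case: e e0 {sub} => a b; rewrite ltcE /= => /andP[/eqP -> a0]; exists a.
have [s s0 vs] : exists2 s : R, 0 <= s & `|v| = s%:C%C.
  by rewrite normc_def; exists (Num.sqrt (complex.Re v ^+ 2 + complex.Im v ^+ 2)).
near=> t; apply: sub; rewrite /ball /= opprD addNKr normrN normrM vs re.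
rewrite normc_def /= expr0n /= addr0 sqrtr_sqr -rmorphM /= ltcR.
rewrite (@le_lt_trans _ _ (`|t| * (s + 1))) ?ler_wpM2l ?lerDl //.
rewrite -ltr_pdivlMr ?ltr_wpDl //.
by near: t; apply: cvgr0_norm_lt; [exact: cvg_id | rewrite divr_gt0 // ltr_wpDl].
Unshelve. all: by end_near. Qed.

Lemma dir_local v (f g : C -> C) w (U : set C^o) : open U -> U w ->
  (forall z, U z -> f z = g z) -> dir_derive v f w = dir_derive v g w.
Proof.
move=> oU Uw fg; rewrite /dir_derive !derive1E.
have H := line_near v oU Uw.
by congr (_ +i* _)%C; apply: near_eq_derive;
  apply: filterS H => t /fg ->.
Qed.

Context {M : riemannSurface R} {n : nat}.

Lemma d_zM (c : chart M) (k l : nat) (A : M -> 'M[C]_(k, n))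
    (B : M -> 'M[C]_(n, l)) (p : M) :
  smooth_on c A -> smooth_on c B -> chart_dom c p ->
  d_z c (fun q => A q *m B q) p = d_z c A p *m B p + A p *m d_z c B p.
Proof.
move=> sA sB cp; have ip := coord_img cp; have pK := coordK cp.
have key v : v = 1 \/ v = 'i%C -> forall i j,
    dir_derive v (fun w => (A (param c w) *m B (param c w)) i j) (coord c p) =
    \sum_h (dir_derive v (fun w => A (param c w) i h) (coord c p) *
              B (param c (coord c p)) h j +
            A (param c (coord c p)) i h * dir_derive v (fun w => B (param c w) h j) (coord c p)).
  move=> vE i j; apply: is_dirE.
  rewrite (_ : (fun w => _) =
     fun w => \sum_h (A (param c w) i h * B (param c w) h j)); last first.
    by apply/funext => w; rewrite mxE.
  apply: is_dir_sum => h.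
  have [_ [/(_ _ ip) [a1 ai] _ _]] := sA i h 1%N.
  have [_ [/(_ _ ip) [b1 bi] _ _]] := sB h j 1%N.
  apply: (@is_dirM v (fun w => A (param c w) i h) (fun w => B (param c w) h j));
    by case: vE => ->; exact: is_dirP.
apply/matrixP => i j; rewrite !mxE /wirt_z (key 1) ?(key 'i%C); last 2 first.
- by right.
- by left.
rewrite pK.
under [in RHS]eq_bigr do rewrite mxE.
under [X in _ = _ + X]eq_bigr do rewrite mxE.
rewrite /wirt_z mulr_sumr -sumrB mulr_sumr -big_split /=.
by apply: eq_bigr => h _; ring.
Qed.

Lemma eq_d_z (c : chart M) (k l : nat) (A B : M -> 'M[C]_(k, l)) (p : M) :
  (forall q, chart_dom c q -> A q = B q) -> chart_dom c p ->
  d_z c A p = d_z c B p.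
Proof.
move=> AB cp; apply/matrixP => i j; rewrite !mxE /wirt_z.
by rewrite !(dir_local _ (@chart_img_open _ M c) (coord_img cp)
  (g := fun w => B (param c w) i j)) // => w /param_dom /AB ->.
Qed.

(* [sff psi chi] is pi_chi o d_z on the sections of psi *)
Lemma sff_section (c : chart M) (psi chi : M -> 'M[C]_n) (s : M -> 'cV[C]_n)
    (p : M) :
  smooth_on c psi -> smooth_on c s -> orthogonal_bundles psi chi ->
  (forall q, chart_dom c q -> psi q *m s q = s q) -> chart_dom c p ->
  sff psi chi c p *m s p = chi p *m d_z c s p.
Proof.
move=> spsi ss ort sec cp.
rewrite -(eq_d_z sec cp) d_zM // mulmxDr -!mulmxA sec // [X in _ + X]mulmxA.
by rewrite ort mul0mx addr0.
Qed.

End SecondFundamentalForm.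

(* Main.v *)
Require Import Defs.
From HB Require Import structures.
From mathcomp Require Import all_boot all_order all_algebra.
From mathcomp Require Import all_classical all_reals all_analysis.
From mathcomp Require Import complex ring lra zify.
From Stdlib Require Ncring Ncring_tac.
Set Implicit Arguments.
Unset Strict Implicit.
Unset Printing Implicit Defensive.

Import Order.TTheory GRing.Theory Num.Theory numFieldNormedType.Exports.
Local Open Scope classical_set_scope.
Local Open Scope ring_scope.
Local Open Scope sesquilinear_scope.

(* Write A = A_z, D = d_z + A and S = - A, so that d_z = D + S; on phi and its
   complement D is diagonal and S off-diagonal.  A factorisation of phi into s
   unitons conjugates D + x S to d_z by Laurent polynomials in x, and it follows
   that, in the expansion of (1 - t D - x S)^-1, all words with more than s
   letters S cancel out.  The words from phi to phi with two letters S form the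
   series T = S (1 - t D)^-1 S = t^(r-1) (c + t e' + ...), and multiplying by
   the words D^j in between shows that N = c + t B + ... is nilpotent, where
   B = e' + c D.  Moreover x B = x e whenever x c = 0, because G^(i) is spanned
   by the image of phi.  Since c^3 = 0, the lowest coefficients of the powers
   of N then give (c^2 e)^q c^2 = 0, hence c^2 e c^2 = 0 as c^2 has rank at most
   one, and then (c^2 e c e)^q c^2 = 0 in the same way. *)

(** * Algebra in a ring with two commuting derivations *)

(** The obstacle is that the coefficients of N beyond c are differential operators, because D
    differentiates. The rule for x B tames only the coefficient of t, so the powers of N are read in
    such a way that B always stands behind a left factor annihilating c. Such a factor is c^2, as
    c^3 = 0; another one is c^2 e c, but only after c^2 e c^2 = 0 is known. This forces the two
    rounds: c^2 e is the lowest coefficient of N^3 on the image of c^2, and once it dies there under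
    a further c^2, the lowest one of N^5 is c^2 e c e. The number 5 bounds the rank of c^2, since
    two Jordan blocks of size three would need a fibre of dimension six. A bundle becomes a
    projection in the ring of matrices of smooth functions on a chart. Filling out zeros becomes a
    cancellation rule for left factors, justified by continuity at the isolated points. Harmonicity
    becomes the commutation of the projection with its Laplacian. *)

Section NoncommutativeRing.
Context (B : pzRingType).

(** The identities below are to hold in matrix rings, whose elements do not commute; these instances
    let [ncring] normalise them. *)
#[local] Instance pzRing_ops :
  @Ncring.Ring_ops B 0 1 +%R *%R (fun x y => x - y) -%R eq := {}.

Lemma pzRing_ncring :
  @Ncring.Ring B 0 1 +%R *%R (fun x y => x - y) -%R eq pzRing_ops.
Proof.
split; [exact: RelationClasses.eq_equivalence | by move=> x y -> ? ? -> ..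
  | by move=> x y -> | exact: add0r | exact: addrC | exact: addrA
  | exact: mul1r | exact: mulr1 | exact: mulrA | exact: mulrDl
  | by move=> *; exact: mulrDr | by [] | exact: subrr].
Qed.

End NoncommutativeRing.
#[local] Existing Instance pzRing_ops.
#[local] Existing Instance pzRing_ncring.
Ltac ncring := Ncring_tac.non_commutative_ring.

(** * Lowest coefficients of the powers of a nilpotent series *)

Section ReturnCycle.
Context {B : pzRingType} {c e : B} {N : (nat -> B) -> nat -> B}.
Context (c3 : c ^+ 3 = 0).
Context (N0 : forall z, N z 0%N = c * z 0%N).
Context (N1 : forall x z, x * c = 0 -> x * N z 1%N = x * (e * z 0%N)).
Context (N_shift : forall z, z 0%N = 0 ->
  forall j, N z j.+1 = N (fun i => z i.+1) j).
Context (N_nil : exists m0, forall m z j, (m0 <= m)%N -> iter m N z j = 0).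

(** A sequence stands for a power series in t, and [N_shift] says that [N] commutes with
    multiplication by t; so do its powers. *)
Lemma iter_shift m z : z 0%N = 0 ->
  forall j, iter m N z j.+1 = iter m N (fun i => z i.+1) j.
Proof.
elim: m z => [//|m IH] z z0 j; rewrite !iterSr IH ?N0 ?z0 ?mulr0 //.
by congr (iter m N _ j); apply/funext => i; rewrite N_shift.
Qed.

Lemma c2c : c ^+ 2 * c = 0. Proof. by rewrite -exprSr c3. Qed.

Lemma cc2 : c * c ^+ 2 = 0. Proof. by rewrite -exprS c3. Qed.

Lemma N_image z y : z 0%N = c ^+ 2 * y -> N z 0%N = 0.
Proof. by move=> zy; rewrite N0 zy mulrA cc2 mul0r. Qed.

(** Three factors [N] gain one power of t on the image of [c ^+ 2]. The rightmost one kills the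
    constant coefficient, as [c * c ^+ 2 = 0]. The other two contribute [c ^+ 2], behind which the
    coefficient of t in [N z] reduces to [e * z 0]. *)
Lemma iter_cycle1 q z y : z 0%N = c ^+ 2 * y ->
  iter (q * 3) N z q = (c ^+ 2 * e) ^+ q * z 0%N.
Proof.
elim: q z y => [|q IH] z y zy; first by rewrite mul1r.
rewrite mulSn addnC iterD.
have N3 : iter 3 N z 1%N = c ^+ 2 * (e * z 0%N).
  by rewrite iterSr iter_shift ?(N_image zy) //= !N0 mulrA -expr2 N1 ?c2c.
have N30 : iter 3 N z 0%N = 0 by rewrite /= N0 N0 (N_image zy) !mulr0.
by rewrite iter_shift // (IH _ _ N3) N3 (exprSr (_ * e)) !mulrA.
Qed.

Lemma cycle1_nilpotent : exists q, (c ^+ 2 * e) ^+ q * c ^+ 2 = 0.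
Proof.
have [m Nm] := N_nil; exists m.
rewrite -(@iter_cycle1 m (fun=> c ^+ 2) 1) ?mulr1 // Nm //.
by rewrite leq_pmulr.
Qed.

(** Five factors [N] gain two powers of t: the first one because [c] kills the image of [c ^+ 2],
    and the second one two factors later, because [c ^+ 2 * e] kills it too. The remaining factors
    spell [c ^+ 2 * e * c * e]. *)
Lemma iter_cycle2 q z y : c ^+ 2 * e * c ^+ 2 = 0 -> z 0%N = c ^+ 2 * y ->
  iter (q * 5) N z (q * 2)%N = (c ^+ 2 * e * c * e) ^+ q * z 0%N.
Proof.
move=> h; elim: q z y => [|q IH] z y zy; first by rewrite mul1r.
rewrite mulSn addnC iterD.
pose x i := N z i.+1.
have x0 : c ^+ 2 * x 0%N = 0.
  by rewrite N1 ?c2c // zy mulrA (mulrA (_ * e)) h mul0r.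
have N2x0 : iter 2 N x 0%N = 0 by rewrite /= !N0 mulrA -expr2.
have N5 i : iter 5 N z i.+1 = iter 2 N (iter 2 N x) i.
  by rewrite iterSr iter_shift ?(N_image zy).
have N50 : iter 5 N z 0%N = 0 by rewrite iterS N0 iterS N0 iterS N0 iterS N0
  [iter 1 _ _ _](N_image zy) !mulr0.
have N51 : iter 5 N z 1%N = 0 by rewrite N5 iterS N0 iterS N0 [iter 0 _ _ _]N2x0
  !mulr0.
have N52 : iter 5 N z 2%N = c ^+ 2 * (e * (c * (e * z 0%N))).
  rewrite N5 iter_shift // iterS N0 iterS N0 /= mulrA -expr2 N1 ?c2c // N0.
  (* By [h] the left factor [c ^+ 2 * e * c] annihilates [c] as well, so [N1] applies once more. *)
  have xc : c ^+ 2 * e * c * c = 0 by rewrite -mulrA -expr2.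
  by have := N1 z xc; rewrite -!(mulrA (c ^+ 2)) -!mulrA => ->.
rewrite mulSn addnC addn2 iter_shift // iter_shift //.
by rewrite (IH _ _ N52) N52 (exprSr (_ * e)) !mulrA.
Qed.

Lemma cycle2_nilpotent : c ^+ 2 * e * c ^+ 2 = 0 ->
  exists q, (c ^+ 2 * e * c * e) ^+ q * c ^+ 2 = 0.
Proof.
move=> h; have [m Nm] := N_nil; exists m.
rewrite -(@iter_cycle2 m (fun=> c ^+ 2) 1) ?mulr1 // Nm //.
by rewrite leq_pmulr.
Qed.

End ReturnCycle.

(** * Projections, harmonicity and unitons in a ring with involution *)

Section DifferentialRing.
Context {B : pzRingType} {d db st : {additive B -> B}}.
Context (dM : forall x y, d (x * y) = d x * y + x * d y).
Context (dbM : forall x y, db (x * y) = db x * y + x * db y).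
Context (stM : forall x y, st (x * y) = st y * st x).
Context (stK : forall x, st (st x) = x).
Context (std : forall x, st (d x) = db (st x)).
Context (ddb : forall x, d (db x) = db (d x)).

Definition projector (P : B) := st P = P /\ P * P = P.

(** A description without points of the projection [Q] onto the image of [N] with zeros filled out:
    [Q] contains the image, and no left factor can tell the two apart. *)
Definition fills (N Q : B) :=
  [/\ projector Q, Q * N = N & forall Y, Y * N = 0 -> Y * Q = 0].

Lemma derivation1 : d 1 = 0.
Proof. by have := dM 1 1; rewrite !mulr1 mul1r => /(congr1 (+%R^~ (- d 1)));
  rewrite addrK subrr. Qed.

Lemma derivation1_bar : db 1 = 0.
Proof. by have := dbM 1 1; rewrite !mulr1 mul1r => /(congr1 (+%R^~ (- db 1)));
  rewrite addrK subrr. Qed.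

Lemma stdb x : st (db x) = d (st x).
Proof. by rewrite -[x in db x]stK -std stK. Qed.

Lemma adjoint1 : st 1 = 1.
Proof. by have := stM 1 (st 1); rewrite !mul1r stK mul1r => <-. Qed.

Lemma idem_d P : P * P = P -> d P * P = (1 - P) * d P.
Proof. by move=> PP; have := dM P P; rewrite PP mulrBl mul1r => {2}->; rewrite
  addrK. Qed.

Lemma idem_db P : P * P = P -> db P * P = (1 - P) * db P.
Proof. by move=> PP; have := dbM P P; rewrite PP mulrBl mul1r => {2}->; rewrite
  addrK. Qed.

Lemma idem_reflection (P : B) : P * P = P -> (P - (1 - P)) * (P - (1 - P)) = 1.
Proof.
move=> PP; transitivity (1 + (P * P - P) *+ 4); first by rewrite !mulrS mulr0n;
  ncring.
by rewrite PP subrr mul0rn addr0.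
Qed.

Lemma idem_dd P : P * P = P -> P * (d P * P) = 0.
Proof. by move=> PP; rewrite idem_d // mulrA mulrBr mulr1 PP subrr mul0r. Qed.

Lemma proj_perp P Q : projector P -> projector Q -> P * Q = 0 -> Q * P = 0.
Proof. by move=> [sP _] [sQ _] /(congr1 st); rewrite stM sP sQ raddf0. Qed.

(* N below is A'_P, written without its redundant left factor 1 - P. *)
Lemma gauss_step P Q :
  projector P -> P * db (d P) = db (d P) * P -> fills (d P * P) Q ->
  [/\ Q * P = 0, Q * d Q = - (d P * P) & Q * db (d Q) = db (d Q) * Q].
Proof.
move=> pP PL [pQ QN cancel]; have [sP PP] := pP; have [sQ QQ] := pQ.
set N := d P * P in QN cancel *.
have PN : P * N = 0 by exact: idem_dd.
have PQ : P * Q = 0 by exact: cancel.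
have QP : Q * P = 0 by exact: proj_perp PQ.
have dPP := idem_d PP; have dbPP := idem_db PP.
have dbN : db N = db (d P) * P + d P * db P by rewrite dbM.
have dN : db Q * N = (1 - Q) * db N.
  by have := dbM Q N; rewrite QN mulrBl mul1r => {1}->; rewrite addrK.
have PdN : (1 - P) * db N = N * db P.
  rewrite dbN mulrDr -PL mulrA mulrBl mul1r PP subrr mul0r add0r.
  by rewrite mulrA -dPP.
(* [Q] is a holomorphic subbundle of the complement of [P]: it suffices to test this on [N], whose
   [db] derivative is [N * db P] modulo [P], by harmonicity. *)
have h1 : (1 - P) * db Q * Q = 0.
  apply: cancel; rewrite -mulrA dN.
  have -> : (1 - P) * ((1 - Q) * db N) =
    (1 - Q) * ((1 - P) * db N) + (P * Q - Q * P) * db N by ncring.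
  rewrite PQ QP subrr mul0r addr0.
  by rewrite PdN mulrA mulrBl QN mul1r subrr mul0r.
have QdQ : Q * d Q = - N.
  have := congr1 st h1; rewrite raddf0 !stM raddfB adjoint1 sP sQ.
  have -> : st (db Q) = d Q by rewrite -[in LHS]sQ -std stK.
  have dQP : d Q * P = - (Q * d P).
    by apply/eqP; rewrite -addr_eq0 -dM QP raddf0.
  rewrite mulrA mulrBr mulr1 => /eqP; rewrite subr_eq0 => /eqP ->.
  rewrite -mulrA dQP mulrN mulrA QQ; congr (- _).
  rewrite -QN /N dPP mulrA mulrBr mulr1 QP subr0.
  by [].
split=> //.
(* Differentiating [Q * d Q = - N] along [db] brings in the Laplacian of [Q]. Between [Q] and
   [1 - Q] all the other terms vanish. *)
have LQ : db Q * d Q + Q * db (d Q) = - (db (d P) * P + d P * db P).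
  by rewrite -dbN -raddfN -QdQ dbM.
have QLQ' : Q * db (d Q) * (1 - Q) = 0.
  have QdbQ : Q * db Q * (d Q * (1 - Q)) = 0.
    have -> : Q * db Q = db Q * (1 - Q) by rewrite mulrBr mulr1 idem_db // mulrBl
      mul1r subKr.
    have -> : d Q * (1 - Q) = Q * d Q by rewrite mulrBr mulr1 idem_d // mulrBl
      mul1r subKr.
    by rewrite mulrA -[_ * (1 - Q) * Q]mulrA mulrBl mul1r QQ subrr mulr0 mul0r.
  have e1 : Q * d P = N by rewrite -[RHS]QN /N dPP mulrA mulrBr mulr1 QP subr0.
  have NQ : N * db P * (1 - Q) = 0.
    have : st ((1 - Q) * N) = 0 by rewrite mulrBl mul1r QN subrr raddf0.
    rewrite stM raddfB adjoint1 sQ /N stM sP std sP => h.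
    by rewrite /N -(mulrA _ P) -mulrA h mulr0.
  have := congr1 (fun x => Q * (x * (1 - Q))) LQ => /=.
  have -> : Q * ((db Q * d Q + Q * db (d Q)) * (1 - Q)) =
    Q * db Q * (d Q * (1 - Q)) + (Q * Q) * db (d Q) * (1 - Q) by ncring.
  have -> : Q * (- (db (d P) * P + d P * db P) * (1 - Q)) =
    - (Q * (db (d P) * P) * (1 - Q) + (Q * d P) * db P * (1 - Q)) by ncring.
  by rewrite QdbQ add0r QQ -PL (mulrA Q P) QP e1 NQ mul0r mul0r addr0 oppr0.
(* The other off-diagonal block is the adjoint of this one, since the Laplacian of [Q] is
   self-adjoint. *)
have : (1 - Q) * (db (d Q) * Q) = 0.
  by rewrite -(raddf0 st) -QLQ' !stM raddfB adjoint1 stdb std sQ ddb.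
rewrite mulrBl mul1r mulrA => /eqP; rewrite subr_eq0 => /eqP ->.
by move/eqP: QLQ'; rewrite mulrBr mulr1 subr_eq0 => /eqP.
Qed.

(* w k j.+1 is the sum of the words with k letters S and j letters D, applied to
   some vector; w k 0 = 0 is padding. *)
Definition flat_array (A : B) (w : nat -> nat -> B) :=
  (forall k, w k 0%N = 0) /\
  forall k j, w k.+1 j.+1 = d (w k.+1 j) + A * w k.+1 j - A * w k j.+1.

(** The row [w 0] is free and encodes the argument, a series in t. The bound says that (1 - t D - x
    S)^-1 maps it to a polynomial in x of degree at most [s]. *)
Definition array_bound (A : B) (s : nat) :=
  forall w, flat_array A w -> forall k j, (s < k)%N -> w k j = 0.

Lemma array_bound0 : array_bound 0 0.
Proof.
move=> w [w0 wS] [//|k] j _; elim: j => [|j IH]; first exact: w0.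
by rewrite wS IH raddf0 !mul0r subr0 addr0.
Qed.

(* On generating functions in x, y is the image of w under p + (t/x) (1 - p),
   which conjugates the operators of A - d p to those of A. *)
Lemma array_boundS A p s : p * p = p -> (1 - p) * A * p = 0 ->
  p * d p = p * A * (1 - p) -> array_bound A s ->
  array_bound (A - d p) s.+1.
Proof.
move=> pp h1 h2 bA w [w0 wS]; set A' := A - d p in wS.
(* At [j = 0] the predecessor is again [0], and the term vanishes thanks to the padding. *)
pose y k j := p * w k j + (1 - p) * w k.+1 j.-1.
have Ap : A * p = p * A * p.
  by move/eqP: h1; rewrite mulrBl mulrBl mul1r subr_eq0 => /eqP.
have pA' : p * A' = A * p.
  by rewrite mulrBr h2 mulrBr mulr1 -Ap subKr.
have p'A' : (1 - p) * A' = A - d p - A * p by rewrite mulrBl mul1r pA'.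
have yA : flat_array A y.
  split=> [k|k [|j]]; first by rewrite /y /= !w0 !mulr0 addr0.
    rewrite /y /= !w0 !mulr0 !addr0 raddf0 mulr0 addr0 sub0r wS w0 raddf0.
    by rewrite mulr0 addr0 sub0r mulrN mulrA pA' mulrA.
  rewrite /y /= (wS k j.+1) (wS k.+1 j) raddfD !dM raddfB derivation1 /=.
  transitivity (p * d (w k.+1 j.+1) + (p * A') * (w k.+1 j.+1 - w k j.+2) +
    (1 - p) * d (w k.+2 j) + ((1 - p) * A') * (w k.+2 j - w k.+1 j.+1)).
    by ncring.
  by rewrite pA' p'A'; ncring.
have yE := bA _ yA.
have pE k j : p * y k j = p * w k j.
  rewrite /y mulrDr !mulrA pp mulrBr mulr1 pp subrr mul0r addr0 //.
(* The division by x on the complement of [p] moves [k.+1] to [k]; this costs one degree, whence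
   [s.+1]. *)
have p'E k j : (1 - p) * y k j.+1 = (1 - p) * w k.+1 j.
  have -> : (1 - p) * y k j.+1 =
    (p - p * p) * (w k j.+1 - w k.+1 j) + (1 - p) * w k.+1 j by rewrite /y /=; ncring.
  by rewrite pp subrr mul0r add0r.
move=> [//|k] j sk; rewrite -[w _ _]mul1r -[1](subrK p) mulrDl -p'E -pE.
by rewrite !yE ?mulr0 ?addr0 // ltnW.
Qed.

Lemma double_inj (tf : forall x : B, x + x = 0 -> x = 0) (x y : B) :
  x + x = y + y -> x = y.
Proof.
by move=> e; apply/eqP; rewrite -subr_eq0; apply/eqP/tf; rewrite addrACA e -opprD
  subrr.
Qed.

(** Uhlenbeck's formula: adding the uniton [p] changes [A] into [A - d p]. The adjoint of the first
    closure condition reads [p * d p = p * A * (1 - p)], and the second one is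
    [(1 - p) * A * p = 0]; these are the conditions of [array_boundS]. Sums such as [A + A] avoid
    the factor 1/2. *)
Lemma uniton_bound (tf : forall x : B, x + x = 0 -> x = 0)
    (psi p A A' C : B) s :
  st psi * psi = 1 -> projector p ->
  A + A = st psi * d psi -> C + C = st psi * db psi ->
  A' + A' = st (psi * (p - (1 - p))) * d (psi * (p - (1 - p))) ->
  (1 - p) * (db p + C * p) = 0 -> (1 - p) * (A * p) = 0 ->
  array_bound A s -> array_bound A' s.+1.
Proof.
move=> psi1 [sp pp] hA hC hA' closed_db closed_A bA.
have stA : st A = - C.
  apply: (double_inj tf); rewrite -raddfD hA -opprD hC stM stK std.
  by apply/eqP; rewrite -addr_eq0 -dbM psi1 derivation1_bar.
have CA : st C = - A by rewrite -[C]opprK -stA raddfN stK.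
have pdp : p * d p = p * A * (1 - p).
  have := congr1 st closed_db.
  rewrite raddf0 stM raddfD stM CA stdb sp raddfB adjoint1 sp mulrN mulrBl => /eqP.
  by rewrite subr_eq0 => /eqP <-; rewrite mulrBr mulr1 idem_d // mulrBl mul1r subKr.
have Ap : (1 - p) * A * p = 0 by rewrite -mulrA.
suff -> : A' = A - d p by exact: array_boundS.
apply: (double_inj tf); rewrite hA' stM !(raddfB st) adjoint1 sp dM !(raddfB d)
  derivation1.
transitivity ((p - (1 - p)) * (st psi * d psi) * (p - (1 - p)) +
  (p - (1 - p)) * (st psi * psi) * (d p + d p)); first by ncring.
rewrite psi1 -hA.
transitivity (A - d p + (A - d p) - (1 - p) * A * p *+ 4 +
  (p * d p - p * A * (1 - p)) *+ 4); first by rewrite !mulrS mulr0n; ncring.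
by rewrite Ap pdp subrr !mul0rn subr0 addr0.
Qed.

(** By the twice differentiated equation [P * P = P], the left-hand side of the harmonic map
    equation is twice the commutator of [P] with its Laplacian. *)
Lemma harmonic_commute (tf : forall x : B, x + x = 0 -> x = 0) P : P * P = P ->
  db ((P - (1 - P)) * d P) + d ((P - (1 - P)) * db P) = 0 ->
  P * db (d P) = db (d P) * P.
Proof.
move=> PP h; set L := db (d P).
have dd : L = L * P + db P * d P + d P * db P + P * L.
  by rewrite /L -[in LHS]ddb -[in LHS]PP dbM raddfD !dM ddb /=; ncring.
apply/eqP; rewrite -subr_eq0; apply/eqP/tf.
have e : L - (L * P + db P * d P + d P * db P + P * L) = 0 by rewrite -dd subrr.
rewrite -h dbM dM ddb !(raddfB d) !(raddfB db) derivation1 derivation1_bar -/L.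
transitivity (P * L - L * P + (P * L - L * P) - (L - (L * P + db P * d P + d P *
  db P + P * L)) *+ 2).
  by rewrite e mul0rn subr0.
rewrite mulr2n; ncring.
Qed.

(** * The Gauss sequence, its return maps and their series *)

Section GaussSequence.
Context {G : nat -> B} {r : nat}.
Context (r_gt0 : (0 < r)%N).
Context (G_proj : forall i, projector (G i)).
Context (G0L : G 0%N * db (d (G 0%N)) = db (d (G 0%N)) * G 0%N).
Context (G_fills : forall i, fills (d (G i) * G i) (G i.+1)).
Context (G0_orth : forall i, (0 < i <= r)%N -> G i * G 0%N = 0).

Let G_idem i : G i * G i = G i. Proof. by case: (G_proj i). Qed.

Lemma gauss_harmonic i : G i * db (d (G i)) = db (d (G i)) * G i.
Proof. by elim: i => [//|i IH]; have [] := gauss_step (G_proj i) IH (G_fills i). Qed.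

(** Equivalently, if u is a section orthogonal to [G i.+1], the component of d u in [G i.+1] is
    A'_{G i} applied to the component of u in [G i]. *)
Lemma gauss_dual i : G i.+1 * d (G i.+1) = - (d (G i) * G i).
Proof. by have [] := gauss_step (G_proj i) (gauss_harmonic i) (G_fills i). Qed.

Lemma gauss_fillK i : G i.+1 * (d (G i) * G i) = d (G i) * G i.
Proof. by case: (G_fills i). Qed.

(** By cancellation it suffices to pair [G j] with the image of A'_{G i}. Moving the derivative to
    the other side, [gauss_dual] turns this into a pairing of [G j.-1] with [G i], which vanishes by
    induction on [i]. *)
Lemma gauss_orth i j : (i < j <= r)%N -> G j * G i = 0.
Proof.
elim: i j => [j|i IH j] /andP[ij jr]; first by apply: G0_orth; rewrite ij.
have ji : G j * G i = 0 by rewrite IH // jr (ltn_trans _ ij).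
have j'i : G j.-1 * G i = 0.
  by apply: IH; rewrite (leq_trans (leq_pred _)) // andbT -ltnS prednK //
    (ltn_trans _ ij).
have [_ _ cancel] := G_fills i; apply: cancel.
have jdi : G j * d (G i) = - (d (G j) * G i).
  by apply/eqP; rewrite -addr_eq0 addrC -dM ji raddf0.
rewrite mulrA jdi mulNr -mulrA G_idem -[d (G j) * _]opprK -jdi opprK.
rewrite -[G j]G_idem -mulrA jdi mulrN mulrA.
rewrite -(prednK (ltn_trans (ltn0Sn _) ij)) gauss_dual mulNr.
by rewrite -mulrA j'i mulr0 !oppr0.
Qed.

Let P := G 0%N.

Lemma orth_G0 i : (0 < i <= r)%N -> P * G i = 0.
Proof. by move=> ir; apply: proj_perp (G0_orth ir). Qed.

(** A'_{G i} lands in [G i.+1], which is still orthogonal to phi when [i < r], so derivatives of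
    sections of [G i] have no component in phi. This makes [S] vanish on these [G i]. *)
Lemma dG0_mid i : (0 < i < r)%N -> d P * G i = 0.
Proof.
move=> /andP[i0 ir].
have PdG : P * (d (G i) * G i) = 0.
  by rewrite -gauss_fillK mulrA orth_G0 ?mul0r.
have := dM P (G i); rewrite orth_G0 ?i0 1?ltnW // raddf0.
move=> /esym/eqP; rewrite addr_eq0 => /eqP e.
by rewrite -[G i]G_idem mulrA e mulNr -mulrA PdG oppr0.
Qed.

Lemma dG0_orth i : (0 < i <= r)%N -> d P * G i = - (P * d (G i)).
Proof.
by move=> ir; apply/eqP; rewrite -addr_eq0 -dM orth_G0 // raddf0.
Qed.


Fixpoint chain i := if i is i'.+1 then (1 - G i') * d (G i') * G i' * chain i' else P.

Lemma chainS i : chain i.+1 = d (G i) * G i * chain i.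
Proof. by rewrite /= -idem_d ?G_idem // -(mulrA _ (G i) (G i)) G_idem. Qed.

(** This is the sense in which the image of phi spans [G i]: the cancellation rules of the
    successive steps compose. *)
Lemma chain_cancel i Y : Y * chain i = 0 -> Y * G i = 0.
Proof.
elim: i Y => [//|i IH] Y; rewrite chainS mulrA => /IH.
rewrite -!mulrA G_idem => h; have [_ _ cancel] := G_fills i; exact: cancel.
Qed.

(** The composite of the maps A' from [G (r - m)] up to [G r]. It is indexed by the number of steps
    left, which the inductions below count. *)
Fixpoint tail_chain m :=
  if m is m'.+1 then tail_chain m' * (d (G (r - m)) * G (r - m)) else 1.

Lemma tail_chainM m : (m <= r)%N -> tail_chain m * chain (r - m) = chain r.
Proof.
elim: m => [|m IH] mr; first by rewrite mul1r subn0.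
by rewrite -(IH (ltnW mr)) -(subnSK mr) chainS mulrA.
Qed.

Let Rem := 1 - \sum_(i < r.+1) G i.

Lemma orth_sum j : (j <= r)%N -> G j * \sum_(i < r.+1) G i = G j.
Proof.
move=> jr; rewrite mulr_sumr (bigD1 (Ordinal (jr : (j < r.+1)%N))) //= G_idem.
rewrite big1 ?addr0 // => i; rewrite -val_eqE /= neq_ltn => /orP[ij|ji].
  by rewrite gauss_orth // ij.
by apply: proj_perp => //; rewrite gauss_orth // ji -ltnS ltn_ord.
Qed.

Lemma G_Rem j : (j <= r)%N -> G j * Rem = 0.
Proof. by move=> jr; rewrite mulrBr mulr1 orth_sum // subrr. Qed.

Lemma Rem_idem : Rem * Rem = Rem.
Proof.
rewrite {1}/Rem mulrBl mul1r mulr_suml big1 ?subr0 // => i _.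
by rewrite G_Rem // -ltnS.
Qed.

Lemma dG0_Rem : d P * Rem = d P * (1 - P - G r).
Proof.
rewrite -addrA -opprD !(mulrBr (d P)); congr (_ - _).
have sumE (f : nat -> B) :
    \sum_(i < r.+1) f i = f 0%N + \sum_(i < r.-1) f i.+1 + f r.
  case: r r_gt0 => // r' _; rewrite big_ord_recl big_ord_recr /= addrA.
  by congr (_ + _ + _); apply: eq_bigr.
rewrite sumE !mulrDr mulr_sumr big1 ?addr0 // => i _; apply: dG0_mid.
by rewrite /= -[ltnRHS](prednK r_gt0) ltnS.
Qed.

Definition return1 := P * d (G r) * G r * chain r.
Definition return2 := P * d Rem * Rem * (Rem * d (G r) * G r) * chain r.

Let eps := - (d P * (1 - P) * (d (G r) * G r)).

(** The remainder R may be replaced by the whole complement of phi: nothing returns to phi from the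
    [G i] with 0 < i < r, and A'_{G r} has no component in [G r]. The sign comes from moving the
    derivative from [Rem] to [P]. *)
Lemma return2E : return2 = eps * chain r.
Proof.
congr (_ * _).
have dR : P * d Rem = - (d P * Rem).
  by apply/eqP; rewrite -addr_eq0 addrC -dM G_Rem ?raddf0.
rewrite dR !mulNr -(mulrA _ Rem Rem) Rem_idem; congr (- _).
have -> : d P * Rem * (Rem * d (G r) * G r) = d P * (Rem * Rem) * (d (G r) * G r).
  by rewrite !mulrA.
rewrite Rem_idem dG0_Rem mulrBr mulrBl -[X in _ - X]mulrA.
by rewrite [G r * (_ * _)]idem_dd // mulr0 subr0.
Qed.

(** [A_z] of the reflection 2P - 1, which is its own inverse and has derivative 2 dP. *)
Let A0 := (P - (1 - P)) * d P.
Let S x := - (A0 * x).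
Let D x := d x + A0 * x.

Lemma S_add x y : S (x + y) = S x + S y.
Proof. by rewrite /S mulrDr opprD. Qed.

Lemma D_add x y : D (x + y) = D x + D y.
Proof. by rewrite /D raddfD mulrDr addrACA. Qed.

Lemma D0 : D 0 = 0. Proof. by rewrite /D raddf0 mulr0 addr0. Qed.
Lemma S0 : S 0 = 0. Proof. by rewrite /S mulr0 oppr0. Qed.

Lemma iterD_add m x y : iter m D (x + y) = iter m D x + iter m D y.
Proof. by elim: m => //= m ->; rewrite D_add. Qed.

Lemma A0E : A0 = d P * (1 - P - P).
Proof.
have -> : A0 = P * d P - (1 - P) * d P by rewrite /A0; ncring.
rewrite -idem_d ?mulrBr -?mulrBr; last exact: G_idem.
have -> : P * d P = d P - (1 - P) * d P by rewrite mulrBl mul1r subKr.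
by rewrite -idem_d ?G_idem //; ncring.
Qed.

Lemma S_on x : P * x = x -> S x = d P * x.
Proof.
by move=> Px; rewrite /S A0E -mulrA !mulrBl mul1r Px subrr sub0r mulrN opprK.
Qed.

Lemma S_off x : P * x = 0 -> S x = - (d P * x).
Proof. by move=> Px; rewrite /S A0E -mulrA !mulrBl mul1r Px !subr0. Qed.

Lemma D_on x : P * x = x -> D x = P * d x.
Proof.
move=> Px; rewrite /D -[A0 * x]opprK -/(S x) S_on // -[X in d X - _]Px dM.
by rewrite addrC addrA addNr add0r.
Qed.

Lemma D_off x : P * x = 0 -> D x = (1 - P) * d x.
Proof.
move=> Px; rewrite /D -[A0 * x]opprK -/(S x) S_off // opprK.
rewrite mulrBl mul1r; congr (_ + _); apply/eqP.
by rewrite -addr_eq0 -dM Px raddf0.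
Qed.

Lemma P_D_on x : P * x = x -> P * D x = D x.
Proof. by move=> Px; rewrite D_on // mulrA G_idem. Qed.

Lemma P_D_off x : P * x = 0 -> P * D x = 0.
Proof. by move=> Px; rewrite D_off // mulrA mulrBr mulr1 G_idem subrr mul0r. Qed.

Lemma P_S_on x : P * x = x -> P * S x = 0.
Proof. by move=> Px; rewrite S_on // -[x in _ * (_ * x)]Px (mulrA (d P)) mulrA
  idem_dd ?mul0r // G_idem. Qed.

Lemma P_S_off x : P * x = 0 -> P * S x = S x.
Proof.
move=> Px; rewrite S_off // mulrN; congr (- _).
by apply/eqP; rewrite -subr_eq0 -opprB oppr_eq0 -{1}[d P * x]mul1r -mulrBl mulrA
  -idem_d ?G_idem // -mulrA Px mulr0.
Qed.

Lemma off_bundle i u : (0 < i <= r)%N -> G i * u = u -> P * u = 0.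
Proof. by move=> ir <-; rewrite mulrA orth_G0 // mul0r. Qed.

(** [D] either moves a section of [G i] up by A' or keeps it in [G i]. At [i = r] the first part may
    have a component in phi, which [1 - P] removes. *)
Lemma D_bundle i u : (0 < i <= r)%N -> G i * u = u ->
  D u = (1 - P) * (d (G i) * G i * u) + G i * d u.
Proof.
move=> ir Gu; rewrite D_off ?(off_bundle ir Gu) //.
have du : d u = d (G i) * G i * u + G i * d u by rewrite -[in LHS]Gu dM -mulrA Gu.
rewrite {1}du mulrDr; congr (_ + _).
by rewrite mulrA mulrBl mul1r orth_G0 // subr0.
Qed.

Lemma D_bundle_mid i u : (0 < i < r)%N -> G i * u = u ->
  D u = d (G i) * G i * u + G i * d u.
Proof.
move=> ir Gu; have ir' : (0 < i <= r)%N by case/andP: ir => -> /ltnW.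
rewrite (D_bundle ir') // mulrBl mul1r -mulrA Gu [P * _]mulrA.
by rewrite -[P * d _]opprK -dG0_orth // dG0_mid // oppr0 mul0r subr0.
Qed.

Lemma G_section i u : G i * (G i * u) = G i * u.
Proof. by rewrite mulrA G_idem. Qed.

Lemma G_step i u : G i.+1 * (d (G i) * G i * u) = d (G i) * G i * u.
Proof. by rewrite mulrA gauss_fillK. Qed.

Lemma tail_index m : (m.+1 < r)%N -> (0 < r - m.+1 < r)%N.
Proof. by move=> mr; rewrite subn_gt0 mr ltn_subrL r_gt0. Qed.

(** Each [D] climbs at most one step, so [b] of them stay below [G r], where [S] vanishes. *)
Lemma S_iterD_lt b m u : (b < m < r)%N -> G (r - m) * u = u ->
  S (iter b D u) = 0.
Proof.
elim: b m u => [|b IH] [//|m] u /andP[bm mr] Gu; have ir := tail_index mr.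
  have ir' : (0 < r - m.+1 <= r)%N by case/andP: ir => -> /ltnW.
  by rewrite /= S_off ?(off_bundle ir' Gu) // -Gu mulrA dG0_mid // mul0r oppr0.
rewrite iterSr (D_bundle_mid ir Gu) iterD_add S_add.
rewrite (IH m.+1 (G _ * d u)) ?G_section ?(ltnW bm) // addr0.
by rewrite (IH m) ?(ltnW mr) ?andbT // -(subnSK (ltnW mr)) G_step.
Qed.

Lemma S_iterD_eq m u : (m < r)%N -> G (r - m) * u = u ->
  S (iter m D u) = P * d (G r) * G r * tail_chain m * u.
Proof.
elim: m u => [|m IH] u mr Gu.
  rewrite subn0 in Gu; have ir : (0 < r <= r)%N by rewrite r_gt0 leqnn.
  rewrite /= mulr1 S_off ?(off_bundle ir Gu) // -!mulrA Gu.
  by rewrite -[in LHS]Gu mulrA dG0_orth // mulNr opprK -mulrA.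
have ir := tail_index mr.
rewrite iterSr (D_bundle_mid ir Gu) iterD_add S_add.
rewrite (@S_iterD_lt m m.+1 (G _ * d u)) ?G_section ?ltnSn // addr0.
by rewrite IH ?(ltnW mr) // -?(subnSK (ltnW mr)) ?G_step //= !mulrA.
Qed.

(** The product is the first return with its initial [r - m] steps removed; as these steps span
    [G (r - m)], what annihilates the whole annihilates the rest. *)
Lemma tail_kill x m : x * return1 = 0 -> (m <= r)%N ->
  x * (P * d (G r) * G r * tail_chain m * G (r - m)) = 0.
Proof.
move=> xc mr; rewrite mulrA; apply: chain_cancel.
by rewrite -mulrA -(mulrA _ (tail_chain m)) tail_chainM.
Qed.

(** There is one [D] more than needed to reach [G r]. If it is spent inside some bundle of the
    sequence, a derivative remains to the right of a truncated first return, and [x] kills the term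
    by [tail_kill]. Otherwise it leads from [G r] into the complement of phi, from where [S]
    returns: this is [eps]. *)
Lemma S_iterD_gt x m u : x * return1 = 0 -> (m < r)%N -> G (r - m) * u = u ->
  x * S (iter m.+1 D u) = x * (eps * tail_chain m * u).
Proof.
move=> xc; elim: m u => [|m IH] u mr Gu.
  rewrite subn0 in Gu; have ir : (0 < r <= r)%N by rewrite r_gt0 leqnn.
  rewrite /= mulr1 (D_bundle ir Gu) S_add mulrDr.
  have -> : S (G r * d u) = P * d (G r) * G r * tail_chain 0 * G (r - 0) * d u.
    by rewrite (@S_iterD_eq 0) ?subn0 ?G_section // mulrA.
  rewrite [X in _ + X]mulrA (tail_kill xc) // mul0r addr0 S_off; last first.
    by rewrite !mulrA mulrBr mulr1 G_idem subrr !mul0r.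
  by rewrite /eps mulNr !mulrA.
have ir := tail_index mr.
rewrite iterSr (D_bundle_mid ir Gu) iterD_add S_add mulrDr.
rewrite (@S_iterD_eq m.+1 (G _ * d u)) ?G_section // [_ * (G _ * _)]mulrA.
rewrite [X in _ + X]mulrA (tail_kill xc) ?(ltnW mr) // mul0r addr0.
by rewrite IH ?(ltnW mr) // -?(subnSK (ltnW mr)) ?G_step //= !mulrA.
Qed.

Lemma S_first v : P * v = v -> S v = d P * P * v /\ G (r - r.-1) * S v = S v.
Proof.
move=> Pv; have -> : (r - r.-1 = 1)%N by rewrite -[X in (X - _)%N](prednK r_gt0)
  subSnn.
have e : S v = d P * P * v by rewrite S_on // -mulrA Pv.
by rewrite e (G_step 0).
Qed.

Lemma tail_first : tail_chain r = tail_chain r.-1 * (d P * P).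
Proof. by rewrite -{1}(prednK r_gt0) /= prednK // subnn. Qed.

Lemma tail_P v : P * v = v -> tail_chain r * v = chain r * v.
Proof. by move=> Pv; rewrite -(tail_chainM (leqnn r)) subnn /= -mulrA Pv. Qed.

Lemma cycle_lt b v : (b < r.-1)%N -> P * v = v -> S (iter b D (S v)) = 0.
Proof.
move=> br Pv; have [_ GS] := S_first Pv.
by apply: S_iterD_lt GS; rewrite br prednK /=.
Qed.

Lemma cycle_eq v : P * v = v -> S (iter r.-1 D (S v)) = return1 * v.
Proof.
move=> Pv; have [Sv GS] := S_first Pv.
rewrite (@S_iterD_eq r.-1) ?prednK // Sv -[return1 * v]mulrA -(tail_P Pv).
by rewrite tail_first !mulrA.
Qed.

Lemma cycle_gt x v : x * return1 = 0 -> P * v = v ->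
  x * S (iter r D (S v)) = x * (return2 * v).
Proof.
move=> xc Pv; have [Sv GS] := S_first Pv.
rewrite -{1}(prednK r_gt0) (@S_iterD_gt _ r.-1) ?prednK // Sv return2E.
by rewrite -(mulrA eps) -(mulrA eps) -tail_P // tail_first !mulrA.
Qed.

(* The series (1 - t D)^-1 z, a series being the sequence of its coefficients. *)
Fixpoint resolvent (z : nat -> B) j :=
  z j + (if j is j'.+1 then D (resolvent z j') else 0).

(* The operator N: the word S D^b S vanishes on phi for b < r.-1. *)
Definition return_series (z : nat -> B) j :=
  S (resolvent (fun i => S (resolvent (fun i => P * z i) i)) (j + r.-1)).

Lemma resolventE z j : resolvent z j = \sum_(i < j.+1) iter (j - i) D (z i).
Proof.
elim: j => [|j IH]; first by rewrite big_ord1 /= addr0.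
rewrite big_ord_recr subnn /= addrC IH; congr (_ + _).
rewrite (big_morph D D_add D0); apply: eq_bigr => i _.
by rewrite subSn // -ltnS.
Qed.

Lemma resolvent_on z : (forall j, P * z j = z j) ->
  forall j, P * resolvent z j = resolvent z j.
Proof.
move=> Pz; elim=> [|j IH] /=; rewrite mulrDr Pz ?mulr0 //.
by rewrite P_D_on.
Qed.

Lemma resolvent_off z : (forall j, P * z j = 0) ->
  forall j, P * resolvent z j = 0.
Proof.
move=> Pz; elim=> [|j IH] /=; rewrite mulrDr Pz ?mulr0 ?addr0 //.
by rewrite P_D_off // addr0.
Qed.

Lemma P_mulK (z : nat -> B) j : P * (P * z j) = P * z j.
Proof. by rewrite mulrA G_idem. Qed.

Lemma S_resolvent_sum u j : S (resolvent (fun i => S (u i)) j) =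
  \sum_(i < j.+1) S (iter (j - i) D (S (u i))).
Proof. by rewrite resolventE (big_morph S S_add S0). Qed.

Lemma return_series_lt u j : (forall i, P * u i = u i) -> (j < r.-1)%N ->
  S (resolvent (fun i => S (u i)) j) = 0.
Proof.
move=> Pu jr; rewrite S_resolvent_sum big1 // => i _.
by apply: cycle_lt => //; rewrite (leq_ltn_trans (leq_subr _ _)).
Qed.

Lemma return1P v : return1 * (P * v) = return1 * v.
Proof.
have cP : chain r * P = chain r.
  by rewrite -(tail_chainM (leqnn r)) subnn -mulrA G_idem.
by rewrite mulrA /return1 -(mulrA _ (chain r)) cP.
Qed.

Lemma return2P v : return2 * (P * v) = return2 * v.
Proof.
have cP : chain r * P = chain r.
  by rewrite -(tail_chainM (leqnn r)) subnn -mulrA G_idem.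
by rewrite mulrA return2E -(mulrA _ (chain r)) cP.
Qed.

Lemma return_series0 z : return_series z 0 = return1 * z 0%N.
Proof.
have Pu := resolvent_on (P_mulK z).
rewrite /return_series add0n S_resolvent_sum big_ord_recl big1 ?addr0; last first.
  move=> i _; apply: cycle_lt => //.
  by rewrite lift0 ltn_subrL /= (leq_ltn_trans _ (ltn_ord i)).
by rewrite subn0 cycle_eq // /= addr0 return1P.
Qed.

(** With u the inner resolvent, only S D^r S u_0 and S D^(r-1) S u_1 can survive. The second is
    [return1] applied to u_1, which carries the derivative of [z 0]; it is killed by [x]. *)
Lemma return_series1 x z : x * return1 = 0 ->
  x * return_series z 1 = x * (return2 * z 0%N).
Proof.
move=> xc; have Pu := resolvent_on (P_mulK z).
rewrite /return_series add1n prednK // S_resolvent_sum mulr_sumr.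
rewrite big_ord_recl big1 ?addr0; last first.
  move=> i _; rewrite lift0.
  have : (r - i.+1 <= r.-1)%N by rewrite leq_subLR addSn -addnS prednK // leq_addl.
  rewrite leq_eqVlt => /orP[/eqP ->|ir]; last by rewrite cycle_lt ?mulr0.
  by rewrite cycle_eq // mulrA xc mul0r.
by rewrite subn0 cycle_gt // /= addr0 return2P.
Qed.

(** As power series, [x] is t^q times [y]. *)
Definition shifted q (x y : nat -> B) :=
  (forall j, (j < q)%N -> x j = 0) /\ forall j, x (j + q)%N = y j.

Lemma shifted_resolvent q x y : shifted q x y ->
  shifted q (resolvent x) (resolvent y).
Proof.
move=> [x0 xy]; have r0 j : (j < q)%N -> resolvent x j = 0.
  elim: j => [|j IH] jq /=; first by rewrite x0 // addr0.
  by rewrite x0 // IH ?(ltnW jq) // D0 addr0.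
split=> //; elim=> [|j IH] /=; last by rewrite -xy -IH.
rewrite add0n -xy add0n; case: q x0 xy r0 => // q x0 xy r0 /=.
by rewrite r0 ?D0.
Qed.

Lemma shifted_S q x y : shifted q x y ->
  shifted q (fun i => S (x i)) (fun i => S (y i)).
Proof. by move=> [x0 xy]; split=> j => [/x0 ->|]; rewrite ?S0 ?xy. Qed.

Lemma shifted_trans p q x y z :
  shifted p x y -> shifted q y z -> shifted (q + p) x z.
Proof.
move=> [x0 xy] [y0 yz]; split=> j => [jq|]; last by rewrite addnA xy yz.
case: (ltnP j p) => [/x0 //|pj]; rewrite -(subnK pj) xy y0 //.
by rewrite ltn_subLR // addnC.
Qed.

Lemma return_series_shift z : z 0%N = 0 -> forall j,
  return_series z j.+1 = return_series (fun i => z i.+1) j.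
Proof.
move=> z0 j.
have sz : shifted 1 (fun i => P * z i) (fun i => P * z i.+1).
  by split=> [[] // _|i]; rewrite ?addn1 // z0 mulr0.
have [_ sh] := shifted_S (shifted_resolvent (shifted_S (shifted_resolvent sz))).
by rewrite /return_series -sh addn1 addSn.
Qed.

Let F x := resolvent (fun i => S (x i)).

Lemma shifted_iter m q x y : shifted q x y -> shifted q (iter m F x) (iter m F y).
Proof. by move=> xy; elim: m => //= m IH; apply/shifted_resolvent/shifted_S. Qed.

Lemma return_series_on z j : P * return_series z j = return_series z j.
Proof.
apply: P_S_off; apply: resolvent_off => i; apply: P_S_on.
exact: resolvent_on (P_mulK z) i.
Qed.

(** Two factors [F] contain two letters [S]; they yield t^(r-1) and one application of the series,
    while the outer resolvent is left for the next pair. *)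
Lemma shifted_return m z :
  shifted (m * r.-1) (iter m.*2 F (resolvent (fun i => P * z i)))
    (resolvent (fun i => P * iter m return_series z i)).
Proof.
elim: m z => [|m IH] z; first by split=> // j; rewrite addn0.
rewrite doubleS !iterSr mulSn addnC.
apply: shifted_trans (IH _); apply/shifted_iter/shifted_resolvent.
split=> j; first by apply: return_series_lt; exact: resolvent_on (P_mulK z).
by rewrite return_series_on.
Qed.

Lemma resolvent_inj0 z : (forall j, resolvent z j = 0) -> forall j, z j = 0.
Proof.
move=> rz [|j]; first by rewrite -(rz 0%N) /= addr0.
by have := rz j.+1; rewrite /= rz D0 addr0.
Qed.

(** [F] leads from each power of x to the next in the inverse of 1 - t D - x S, so the bound gives
    F^k = 0 for k > s. Up to a power of t and the invertible resolvent, the m-th power of the series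
    is F^(2m). *)
Lemma return_nilpotent s : array_bound A0 s ->
  exists m0, forall m z j, (m0 <= m)%N -> iter m return_series z j = 0.
Proof.
move=> bA; exists s.+1 => -[//|m] z j sm.
have F0 k x : (s < k)%N -> forall i, iter k F x i = 0.
  move=> sk i; pose w k i := if i is i'.+1 then iter k F x i' else 0.
  apply: (bA w _ k i.+1) => //; split=> // k' [|j'] /=.
    by rewrite raddf0 mulr0 addr0 sub0r /F /= addr0.
  by rewrite /F /= addrC.
have [_ sh] := shifted_return m.+1 z.
suff h : forall i, P * iter m.+1 return_series z i = 0.
  by have := h j; rewrite iterS return_series_on.
by apply: resolvent_inj0 => i; rewrite -sh F0 // -addnn (leq_trans sm) // leq_addr.
Qed.

Lemma return_cycle1 s : array_bound A0 s -> return1 ^+ 3 = 0 ->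
  exists q, (return1 ^+ 2 * return2) ^+ q * return1 ^+ 2 = 0.
Proof.
move=> /return_nilpotent Nnil c3; exact: (cycle1_nilpotent c3 return_series0
  (fun x z => @return_series1 x z) return_series_shift Nnil).
Qed.

Lemma return_cycle2 s : array_bound A0 s -> return1 ^+ 3 = 0 ->
  return1 ^+ 2 * return2 * return1 ^+ 2 = 0 ->
  exists q, (return1 ^+ 2 * return2 * return1 * return2) ^+ q * return1 ^+ 2 = 0.
Proof.
move=> /return_nilpotent Nnil c3; exact: (cycle2_nilpotent c3 return_series0
  (fun x z => @return_series1 x z) return_series_shift Nnil).
Qed.

End GaussSequence.
End DifferentialRing.

(** * Smooth functions of a complex variable *)

Section Schwarz.
Context {R : realType}.

Lemma is_derive_shift (g : R -> R) (a l : R) :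
  is_derive (0:R) (1:R) (fun t => g (a + t)) l -> is_derive (a:R) (1:R) g l.
Proof.
have E : (fun h : R => h^-1 *: (((fun t => g (a + t)) \o shift 0) (h *: 1) - g (a
  + 0))) =
         (fun h : R => h^-1 *: ((g \o shift a) (h *: 1) - g a)).
  by apply/funext => h; rewrite /= !addr0 [a + _]addrC.
by move=> [dg <-]; split; rewrite /derivable /derive /= ?E // -E.
Qed.

Lemma mean_value0 (f df : R -> R) (h : R) : 0 < h ->
  (forall x, 0 <= x <= h -> is_derive (x:R) (1:R) f (df x)) ->
  exists2 c, 0 < c < h & f h - f 0 = df c * h.
Proof.
move=> h0 fd; have [| |c ch ->] := @MVT _ f df 0 h h0.
- by move=> x; rewrite in_itv /= => /andP[x0 xh]; apply: fd; rewrite !ltW.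
- apply: derivable_within_continuous => x; rewrite in_itv /= => xh.
  exact: (@ex_derive _ _ _ _ _ _ _ (fd x xh)).
- by exists c; rewrite ?subr0 //; move: ch; rewrite in_itv.
Qed.

(* The second difference of F over the square of side h equals both
   h^2 * Fab and h^2 * Fba at some points of the square. *)
Lemma second_difference (F Fa Fab : R -> R -> R) (h : R) : 0 < h ->
  (forall a b, 0 <= a <= h -> 0 <= b <= h ->
    is_derive (a:R) (1:R) (F^~ b) (Fa a b) /\ is_derive (b:R) (1:R) (Fa a) (Fab a
      b)) ->
  exists a b, [/\ 0 < a < h, 0 < b < h &
    F h h - F h 0 - (F 0 h - F 0 0) = Fab a b * h * h].
Proof.
move=> h0 D.
have hh : 0 <= h <= h by rewrite lexx ltW.
have h00 : (0 : R) <= (0 : R) <= h by rewrite lexx ltW.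
have [|a ah] := @mean_value0 (fun a => F a h - F a 0) (fun a => Fa a h - Fa a 0) h h0.
  move=> a ah; have [d1 _] := D a h ah hh; have [d2 _] := D a 0 ah h00.
  exact: is_deriveB.
have ah' : 0 <= a <= h by case/andP: ah => a0 ah; rewrite !ltW.
have [|b bh ->] := @mean_value0 (Fa a) (Fab a) h h0.
  by move=> b bh; have [] := D a b ah' bh.
by move=> e; exists a, b; split => //; rewrite -e; ring.
Qed.

(** If the mixed derivatives differed at 0, both would stay within half their distance of these
    values on a small square; but the second difference makes a value of one equal to a value of the
    other. *)
Lemma schwarz_real (F Fa Fb Fab Fba : R -> R -> R) :
  (forall e, 0 < e -> exists2 h, 0 < h &
     forall a b, 0 <= a <= h -> 0 <= b <= h ->
     [/\ is_derive (a : R) (1 : R) (F^~ b) (Fa a b),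
         is_derive (b : R) (1 : R) (Fa a) (Fab a b),
         is_derive (b : R) (1 : R) (F a) (Fb a b) &
         is_derive (a : R) (1 : R) (Fb^~ b) (Fba a b)] /\
     `|Fab a b - Fab 0 0| < e /\ `|Fba a b - Fba 0 0| < e) ->
  Fab 0 0 = Fba 0 0.
Proof.
move=> near0; apply/eqP; apply: contraT => ne.
have e0 : 0 < `|Fab 0 0 - Fba 0 0| / 2 by rewrite divr_gt0 // normr_gt0 subr_eq0.
have [h h0 Dh] := near0 _ e0.
have [a [b [ah bh e1]]] : exists a b, [/\ 0 < a < h, 0 < b < h &
    F h h - F h 0 - (F 0 h - F 0 0) = Fab a b * h * h].
  by apply: (@second_difference F Fa) => // a b ah bh; have [[]] := Dh a b ah bh.
have [b' [a' [bh' ah' e2]]] : exists b a, [/\ 0 < b < h, 0 < a < h &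
    F h h - F 0 h - (F h 0 - F 0 0) = Fba a b * h * h].
  apply: (@second_difference (fun b a => F a b) (fun b a => Fb a b) (fun b a =>
    Fba a b)) => // b' a' bh' ah'.
  by have [[]] := Dh a' b' ah' bh'.
have E : Fab a b = Fba a' b'.
  have hn : h * h != 0 by rewrite mulf_neq0 // gt_eqF.
  by apply: (mulIf hn); rewrite !mulrA -e1 -e2; ring.
have w x : 0 < x < h -> 0 <= x <= h by move=> /andP[x0 xh]; rewrite !ltW.
have [_ [c1 _]] := Dh a b (w _ ah) (w _ bh).
have [_ [_ c2]] := Dh a' b' (w _ ah') (w _ bh').
have : `|Fab 0 0 - Fba 0 0| < `|Fab 0 0 - Fba 0 0|.
  have -> : Fab 0 0 - Fba 0 0 = (Fba a' b' - Fba 0 0) - (Fab a b - Fab 0 0) by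
    rewrite E; ring.
  apply: le_lt_trans (ler_normB _ _) _.
  have -> : Fba a' b' - Fba 0 0 - (Fab a b - Fab 0 0) = Fab 0 0 - Fba 0 0 by
    rewrite E; ring.
  lra.
by rewrite ltxx.
Qed.

End Schwarz.

(** * Closure properties of smooth functions *)

Section SmoothCalculus.
Context {R : realType}.
Local Notation C := (R[i]).
Implicit Types (f g : C -> C) (U : set C^o) (w v : C).

Lemma is_dir_derivable v f w l : is_dir v f w l -> dir_derivable v f w.
Proof. by move=> [f1 f2]; split; [exact: (@ex_derive _ _ _ _ _ _ _ f1) | exact:
  (@ex_derive _ _ _ _ _ _ _ f2)]. Qed.

Lemma is_dir_cst v (k : C) w : is_dir v (fun=> k) w 0.
Proof. by split; exact: is_derive_cst. Qed.

Lemma is_dirD v f g w a b : is_dir v f w a -> is_dir v g w b ->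
  is_dir v (fun z => f z + g z) w (a + b).
Proof.
move=> fa gb; have := @is_dir_sum _ v w 2 (fun i => if i == 0 then f else g)
  (fun i => if i == 0 then a else b).
rewrite big_ord_recl big_ord1 /= => h.
have -> : (fun z => f z + g z) = (fun z => \sum_(i < 2) (if i == 0 then f else g) z).
  by apply/funext => z; rewrite big_ord_recl big_ord1.
by apply: h => i; case: ifP.
Qed.

Lemma is_dir_conj v f w a : is_dir v f w a ->
  is_dir v (fun z => (f z)^*%C) w (a^*)%C.
Proof.
move=> [fr fi]; split.
- rewrite (_ : (fun t => _) = fun t : R => complex.Re (f (w + t%:C%C * v))).
    by case: a fr fi.
  by apply/funext => t; case: (f _).
- rewrite (_ : (fun t => _) = - fun t : R => complex.Im (f (w + t%:C%C * v))).
    by case: a fr fi => /= a b _ fi; exact: is_deriveN.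
  by apply/funext => t; rewrite fctE; case: (f _).
Qed.

Lemma dir_derivable_local v f g w U : open U -> U w ->
  (forall z, U z -> f z = g z) -> dir_derivable v f w -> dir_derivable v g w.
Proof.
move=> oU Uw fg; have H := line_near v oU Uw.
by move=> [fr fi]; split; [move: fr | move: fi]; apply: near_eq_derivable;
  apply: filterS H => t /fg ->.
Qed.

Lemma continuous_local f g w U : open U -> U w ->
  (forall z, U z -> f z = g z) ->
  {for w, continuous (f : C^o -> C^o)} -> {for w, continuous (g : C^o -> C^o)}.
Proof.
move=> oU Uw fg; rewrite /prop_for /continuous_at -(fg _ Uw).
have nU : nbhs (w : C^o) U by exact: open_nbhs_nbhs.
apply: cvg_trans; apply: near_eq_cvg; first exact: nbhs_filter.
by apply: filterS nU => z /fg ->.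
Qed.

Lemma Ck_local k U f g : open U -> (forall z, U z -> f z = g z) ->
  Ck k U f -> Ck k U g.
Proof.
move=> oU; elim: k f g => [|k IH] f g fg [cf] /= => [_|[df f1 fi]].
  by split=> [w Uw|//]; apply: (continuous_local oU Uw fg (cf w Uw)).
split=> [w Uw|]; first exact: (continuous_local oU Uw fg (cf w Uw)).
split=> [w Uw||].
- by have [? ?] := df w Uw; split; apply: (dir_derivable_local oU Uw fg).
- by apply: IH f1 => w Uw; exact: (dir_local _ oU Uw fg).
- by apply: IH fi => w Uw; exact: (dir_local _ oU Uw fg).
Qed.

(** For Leibniz' rule, where a function itself appears next to a derivative of one order less. *)
Lemma CkW k U f : Ck k.+1 U f -> Ck k U f.
Proof.
elim: k f => [|k IH] f [cf [df f1 fi]]; first exact: (conj cf I).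
exact: (conj cf (And3 df (IH _ f1) (IH _ fi))).
Qed.

Lemma Ck_cst k U (a : C) : Ck k U (fun=> a).
Proof.
have d0 v b : dir_derive v (fun=> b) = fun=> 0.
  by apply/funext => w; exact: is_dirE (is_dir_cst v b w).
elim: k a => [|k IH] a; first by split=> [w _|//]; exact: cst_continuous.
split=> [w _|]; first exact: cst_continuous.
split; [|by rewrite d0 ..].
by move=> w _; split; exact: is_dir_derivable (is_dir_cst _ a w).
Qed.

Lemma CkD k U f g : open U -> Ck k U f -> Ck k U g ->
  Ck k U (fun z => f z + g z).
Proof.
move=> oU; elim: k f g => [|k IH] f g [cf hf] [cg hg].
  by split=> [w Uw|//]; exact: cvgD (cf w Uw) (cg w Uw).
split=> [w Uw|]; first exact: cvgD (cf w Uw) (cg w Uw).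
case: hf hg => df f1 fi [dg g1 gi].
have dE v w : dir_derivable v f w -> dir_derivable v g w ->
    is_dir v (fun z => f z + g z) w (dir_derive v f w + dir_derive v g w).
  by move=> /is_dirP ? /is_dirP ?; exact: is_dirD.
split=> [w Uw||].
- have [? ?] := df w Uw; have [? ?] := dg w Uw.
  by split; apply: is_dir_derivable; exact: dE.
- apply: Ck_local (IH _ _ f1 g1) => // w Uw.
  by rewrite (is_dirE (dE _ _ _ _)) //; [case: (df w Uw)|case: (dg w Uw)].
- apply: Ck_local (IH _ _ fi gi) => // w Uw.
  by rewrite (is_dirE (dE _ _ _ _)) //; [case: (df w Uw)|case: (dg w Uw)].
Qed.

Lemma CkM k U f g : open U -> Ck k U f -> Ck k U g ->
  Ck k U (fun z => f z * g z).
Proof.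
move=> oU; elim: k f g => [|k IH] f g Cf Cg.
  case: Cf Cg => cf _ [cg _]; exact: (conj (fun w Uw => cvgM (cf w Uw) (cg w Uw)) I).
have [cf [df f1 fi]] := Cf; have [cg [dg g1 gi]] := Cg.
split=> [w Uw|]; first exact: cvgM (cf w Uw) (cg w Uw).
have dE v w : dir_derivable v f w -> dir_derivable v g w ->
    is_dir v (fun z => f z * g z) w (dir_derive v f w * g w + f w * dir_derive v g w).
  by move=> /is_dirP ? /is_dirP ?; exact: is_dirM.
split=> [w Uw||].
- have [? ?] := df w Uw; have [? ?] := dg w Uw.
  by split; apply: is_dir_derivable; exact: dE.
- apply: Ck_local (CkD oU (IH _ _ f1 (CkW Cg)) (IH _ _ (CkW Cf) g1)) => // w Uw.
  by rewrite (is_dirE (dE _ _ _ _)) //; [case: (df w Uw)|case: (dg w Uw)].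
- apply: Ck_local (CkD oU (IH _ _ fi (CkW Cg)) (IH _ _ (CkW Cf) gi)) => // w Uw.
  by rewrite (is_dirE (dE _ _ _ _)) //; [case: (df w Uw)|case: (dg w Uw)].
Qed.

Lemma conjc_continuous : continuous ((@conjc R) : C^o -> C^o).
Proof.
move=> w; apply/(@cvgrPdist_lt _ _ _ _ (nbhs_filter w)) => e e0.
by apply/nbhs_ballP; exists e => // z; rewrite /ball /= -rmorphB normcJ.
Qed.

Lemma Ck_conj k U f : open U -> Ck k U f -> Ck k U (fun z => (f z)^*%C).
Proof.
move=> oU; elim: k f => [|k IH] f [cf hf].
  by split=> [w Uw|//]; exact: (cvg_comp _ _ (cf w Uw) (@conjc_continuous _)).
split=> [w Uw|]; first exact: (cvg_comp _ _ (cf w Uw) (@conjc_continuous _)).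
case: hf => df f1 fi.
have dE v w : dir_derivable v f w ->
    is_dir v (fun z => (f z)^*%C) w (dir_derive v f w)^*%C.
  by move=> /is_dirP ?; exact: is_dir_conj.
split=> [w Uw||].
- have [? ?] := df w Uw.
  by split; apply: is_dir_derivable; exact: dE.
- apply: Ck_local (IH _ f1) => // w Uw.
  by rewrite (is_dirE (dE _ _ _)) //; case: (df w Uw).
- apply: Ck_local (IH _ fi) => // w Uw.
  by rewrite (is_dirE (dE _ _ _)) //; case: (df w Uw).
Qed.

Lemma square_near w (V : set C^o) : nbhs (w : C^o) V -> exists2 h : R, 0 < h &
  forall a b : R, 0 <= a <= h -> 0 <= b <= h ->
    V (w + a%:C%C * 1 + b%:C%C * 'i%C).
Proof.
move=> /nbhs_ballP[e /= e0 sub].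
have [r r0 re] : exists2 r : R, 0 < r & e = r%:C%C.
  by case: e e0 {sub} => a b; rewrite ltcE /= => /andP[/eqP -> a0]; exists a.
exists (r / 3); first by rewrite divr_gt0.
move=> a b /andP[a0 ah] /andP[b0 bh]; apply: sub; rewrite /ball /= -addrA opprD
  addNKr normrN.
apply: le_lt_trans (ler_normD _ _) _; rewrite re !normrM normr1 mulr1.
have -> : `|'i%C : C| = 1 by rewrite normc_def /= expr0n expr1n add0r sqrtr1.
rewrite mulr1 !normc_def /= !expr0n /= !addr0 !sqrtr_sqr -rmorphD ltcR !ger0_norm //.
by have := r0; lra.
Qed.

Lemma dir_deriveC U f w : open U -> U w -> Ck 2 U f ->
  dir_derive 'i%C (dir_derive 1 f) w = dir_derive 1 (dir_derive 'i%C f) w.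
Proof.
move=> oU Uw [_ [df [_ [df1 _ [cf1i _]]] [_ [dfi [cfi1 _] _]]]].
pose pt (a b : R) : C := w + a%:C%C * 1 + b%:C%C * 'i%C.
have pt0 : pt 0 0 = w by rewrite /pt rmorph0 !mul0r !addr0.
have pt1 a b t : pt (a + t) b = pt a b + t%:C%C * 1 by rewrite /pt rmorphD; ring.
have pti a b t : pt a (b + t) = pt a b + t%:C%C * 'i%C by rewrite /pt rmorphD /=;
  ring.
(* The mean value theorem is real, so real and imaginary parts are treated separately; [pr] is
   either of them. *)
suff key (pr : C -> R) : pr = @complex.Re R \/ pr = @complex.Im R ->
    pr (dir_derive 'i%C (dir_derive 1 f) w) = pr (dir_derive 1 (dir_derive 'i%C f) w).
  apply/eqP; rewrite eq_complex; apply/andP; split; apply/eqP; apply: key; tauto.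
move=> prE.
have prD x y : pr (x - y) = pr x - pr y by case: prE => ->; rewrite raddfB.
have prn x : `|pr x|%:C%C <= `|x|.
  case: prE => -> {prD}; first exact: normc_ge_Re.
  have -> : complex.Im x = - complex.Re (x * 'i%C) by case: x => a b /=; ring.
  rewrite normrN; apply: le_trans (normc_ge_Re _) _; rewrite normrM.
  by have -> : `|'i%C : C| = 1; [rewrite normc_def /= expr0n expr1n add0r
    sqrtr1|rewrite mulr1].
have line g a b v : dir_derivable v g (pt a b) ->
    is_derive (0:R) (1:R) (fun t : R => pr (g (pt a b + t%:C%C * v))) (pr
      (dir_derive v g (pt a b))).
  by move=> /is_dirP[gr gi]; case: prE => ->.
have line1 g a b : dir_derivable 1 g (pt a b) ->
    is_derive (a:R) (1:R) (fun a => pr (g (pt a b))) (pr (dir_derive 1 g (pt a b))).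
  move=> dg; have := line g a b 1 dg.
  have -> : (fun t : R => pr (g (pt a b + t%:C%C * 1))) = (fun t : R => pr (g (pt
    (a + t) b))).
    by apply/funext => t; rewrite pt1.
  exact (@is_derive_shift R (fun a => pr (g (pt a b))) a _).
have linei g a b : dir_derivable 'i%C g (pt a b) ->
    is_derive (b:R) (1:R) (fun b => pr (g (pt a b))) (pr (dir_derive 'i%C g (pt a
      b))).
  move=> dg; have := line g a b 'i%C dg.
  have -> : (fun t : R => pr (g (pt a b + t%:C%C * 'i%C))) = (fun t : R => pr (g
    (pt a (b + t)))).
    by apply/funext => t; rewrite pti.
  exact (@is_derive_shift R (fun b => pr (g (pt a b))) b _).
rewrite -pt0.
apply: (@schwarz_real _ (fun a b => pr (f (pt a b)))
  (fun a b => pr (dir_derive 1 f (pt a b)))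
  (fun a b => pr (dir_derive 'i%C f (pt a b)))
  (fun a b => pr (dir_derive 'i%C (dir_derive 1 f) (pt a b)))
  (fun a b => pr (dir_derive 1 (dir_derive 'i%C f) (pt a b)))) => e e0.
have prc g : {for w, continuous (g : C^o -> C^o)} ->
    nbhs (w : C^o) [set z | `|pr (g z) - pr (g w)| < e].
  move=> /cvgrPdist_lt/(_ e%:C%C); rewrite ltcR => /(_ e0); apply: filterS => z /= h.
  by rewrite distrC -prD -ltcR; exact: le_lt_trans (prn _) h.
have [h h0 H] := square_near (filterI (open_nbhs_nbhs (conj oU Uw))
  (filterI (prc _ (cf1i w Uw)) (prc _ (cfi1 w Uw)))).
exists h; [exact: h0|move=> a b ah bh]; have [Up [c1 c2]] := H a b ah bh; rewrite pt0.
split; last exact: (conj c1 c2).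
have [d1 d2] := df _ Up; have [_ d3] := df1 _ Up; have [d4 _] := dfi _ Up.
exact: And4 (line1 _ _ _ d1) (linei _ _ _ d3) (linei _ _ _ d2) (line1 _ _ _ d4).
Qed.

End SmoothCalculus.

(** * The commutative ring of smooth functions on a chart *)

Section SmoothRing.
Context {R : realType} {M : riemannSurface R} {c : chart M}.
Local Notation C := (R[i]).
Let U : set C^o := chart_img c.
Let oU : open U := @chart_img_open R M c.

(* Values outside the image of the chart are normalised to 0, so that equality
   of such functions is equality on the image. *)
Record smooth_fun := SmoothFun {
  smooth_val :> C -> C ;
  smooth_valP : forall k, Ck k U smooth_val ;
  smooth_val0 : forall w, ~ U w -> smooth_val w = 0 }.

Lemma smooth_ext (f g : smooth_fun) : (forall w, U w -> f w = g w) -> f = g.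
Proof.
case: f g => [f Cf f0] [g Cg g0] /= fg.
have e : f = g.
  by apply/funext => w; have [/fg //|nU] := pselect (U w); rewrite f0 // g0.
by case: _ / e Cg g0 {fg} => Cg g0; congr SmoothFun; exact: Prop_irrelevance.
Qed.

Let cut (f : C -> C) (w : C) : C := if `[< U w >] then f w else 0.

Let cutE f w : U w -> cut f w = f w. Proof. by rewrite /cut => /asboolT ->. Qed.

Let cut0 f w : ~ U w -> cut f w = 0. Proof. by rewrite /cut => /asboolF ->. Qed.

Let cut_Ck f : (forall k, Ck k U f) -> forall k, Ck k U (cut f).
Proof. by move=> Cf k; apply: Ck_local (Cf k) => // w Uw; rewrite cutE. Qed.

Definition mk_smooth f (Cf : forall k, Ck k U f) : smooth_fun :=
  SmoothFun (cut_Ck Cf) (@cut0 f).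

Lemma mk_smoothE f (Cf : forall k, Ck k U f) w : U w -> mk_smooth Cf w = f w.
Proof. exact: cutE. Qed.

Definition smooth_cst (a : C) := mk_smooth (fun k => Ck_cst k U a).

Definition smooth_add (f g : smooth_fun) :=
  mk_smooth (fun k => CkD oU (smooth_valP f k) (smooth_valP g k)).

Definition smooth_mul (f g : smooth_fun) :=
  mk_smooth (fun k => CkM oU (smooth_valP f k) (smooth_valP g k)).

Definition smooth_opp (f : smooth_fun) := smooth_mul (smooth_cst (-1)) f.

HB.instance Definition _ := gen_eqMixin smooth_fun.
HB.instance Definition _ := gen_choiceMixin smooth_fun.

Fact smooth_addA : associative smooth_add.
Proof. by move=> f g h; apply: smooth_ext => w Uw; rewrite !mk_smoothE // addrA. Qed.

Fact smooth_addC : commutative smooth_add.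
Proof. by move=> f g; apply: smooth_ext => w Uw; rewrite !mk_smoothE // addrC. Qed.

Fact smooth_add0 : left_id (smooth_cst 0) smooth_add.
Proof. by move=> f; apply: smooth_ext => w Uw; rewrite !mk_smoothE // add0r. Qed.

Fact smooth_addN : left_inverse (smooth_cst 0) smooth_opp smooth_add.
Proof.
by move=> f; apply: smooth_ext => w Uw; rewrite !mk_smoothE // mulN1r addNr.
Qed.

HB.instance Definition _ := GRing.isZmodule.Build smooth_fun
  smooth_addA smooth_addC smooth_add0 smooth_addN.

Fact smooth_mulA : associative smooth_mul.
Proof. by move=> f g h; apply: smooth_ext => w Uw; rewrite !mk_smoothE // mulrA. Qed.

Fact smooth_mulC : commutative smooth_mul.
Proof. by move=> f g; apply: smooth_ext => w Uw; rewrite !mk_smoothE // mulrC. Qed.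

Fact smooth_mul1 : left_id (smooth_cst 1) smooth_mul.
Proof. by move=> f; apply: smooth_ext => w Uw; rewrite !mk_smoothE // mul1r. Qed.

Fact smooth_mulDl : left_distributive smooth_mul smooth_add.
Proof. by move=> f g h; apply: smooth_ext => w Uw; rewrite !mk_smoothE // mulrDl. Qed.

HB.instance Definition _ := GRing.Zmodule_isComPzRing.Build smooth_fun
  smooth_mulA smooth_mulC smooth_mul1 smooth_mulDl.

End SmoothRing.
Arguments smooth_fun {R M} c.

(** * Wirtinger derivatives *)

Section Wirtinger.
Context {R : realType}.
Local Notation C := (R[i]).
Implicit Types (f g : C -> C) (U : set C^o).

Lemma Ck_succ U f w : (forall k, Ck k U f) -> U w ->
  dir_derivable 1 f w /\ dir_derivable 'i%C f w.
Proof. by move=> Cf Uw; have [_ [df _ _]] := Cf 1%N; exact: df. Qed.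

Lemma Ck_dir U f : (forall k, Ck k U f) ->
  (forall k, Ck k U (dir_derive 1 f)) /\ (forall k, Ck k U (dir_derive 'i%C f)).
Proof. by move=> Cf; split=> k; have [_ []] := Cf k.+1. Qed.

Lemma Ck_wirt U f : open U -> (forall k, Ck k U f) ->
  (forall k, Ck k U (wirt_z f)) /\ (forall k, Ck k U (wirt_zbar f)).
Proof.
move=> oU /Ck_dir[C1 Ci].
have Cl (a b : C) k : Ck k U (fun w => a * (dir_derive 1 f w + b * dir_derive
  'i%C f w)).
  exact: CkM oU (Ck_cst _ _ _) (CkD oU (C1 k) (CkM oU (Ck_cst _ _ _) (Ci k))).
split=> k; last exact: Cl.
apply: Ck_local oU _ (Cl 2^-1 (- 'i%C) k) => w _.
by rewrite /wirt_z mulNr.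
Qed.

Lemma wirt_local U f g w : open U -> U w -> (forall z, U z -> f z = g z) ->
  wirt_z f w = wirt_z g w /\ wirt_zbar f w = wirt_zbar g w.
Proof.
by move=> oU Uw fg; rewrite /wirt_z /wirt_zbar !(dir_local _ oU Uw fg).
Qed.

Section Rules.
Context {U : set C^o} {f g : C -> C} {w : C}.
Context (oU : open U) (Uw : U w).
Context (Cf : forall k, Ck k U f) (Cg : forall k, Ck k U g).

Let df := Ck_succ Cf Uw.
Let dg := Ck_succ Cg Uw.

Lemma wirtD : wirt_z (fun z => f z + g z) w = wirt_z f w + wirt_z g w /\
  wirt_zbar (fun z => f z + g z) w = wirt_zbar f w + wirt_zbar g w.
Proof.
have [f1 fi] := df; have [g1 gi] := dg.
rewrite /wirt_z /wirt_zbar (is_dirE (is_dirD (is_dirP f1) (is_dirP g1))).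
by rewrite (is_dirE (is_dirD (is_dirP fi) (is_dirP gi))); split; ring.
Qed.

Lemma wirtM : wirt_z (fun z => f z * g z) w = wirt_z f w * g w + f w * wirt_z g w /\
  wirt_zbar (fun z => f z * g z) w = wirt_zbar f w * g w + f w * wirt_zbar g w.
Proof.
have [f1 fi] := df; have [g1 gi] := dg.
rewrite /wirt_z /wirt_zbar (is_dirE (is_dirM (is_dirP f1) (is_dirP g1))).
by rewrite (is_dirE (is_dirM (is_dirP fi) (is_dirP gi))); split; ring.
Qed.

Lemma wirt_conj : (wirt_z f w)^*%C = wirt_zbar (fun z => (f z)^*%C) w.
Proof.
have [f1 fi] := df.
rewrite /wirt_z /wirt_zbar (is_dirE (is_dir_conj (is_dirP f1))).
rewrite (is_dirE (is_dir_conj (is_dirP fi))) rmorphM rmorphB rmorphM fmorphV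
  rmorph_nat.
rewrite -[X in _ = _ * (_ + X * _)]opprK mulNr; congr (_ * (_ - _ * _)).
by apply/eqP; rewrite eq_complex /= oppr0 !eqxx.
Qed.

Lemma wirt_comm : wirt_z (wirt_zbar f) w = wirt_zbar (wirt_z f) w.
Proof.
have [C1 Ci] := Ck_dir Cf; have [d11 d1i] := Ck_succ C1 Uw; have [di1 dii] :=
  Ck_succ Ci Uw.
have D v (a b : C) : v = 1 \/ v = 'i%C ->
    dir_derive v (fun w => a * (dir_derive 1 f w + b * dir_derive 'i%C f w)) w =
    a * (dir_derive v (dir_derive 1 f) w + b * dir_derive v (dir_derive 'i%C f) w).
  move=> vE; apply: is_dirE.
  have h1 : is_dir v (dir_derive 1 f) w (dir_derive v (dir_derive 1 f) w).
    by case: vE => ->; [exact: (is_dirP d11)|exact: (is_dirP d1i)].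
  have h2 : is_dir v (dir_derive 'i%C f) w (dir_derive v (dir_derive 'i%C f) w).
    by case: vE => ->; [exact: (is_dirP di1)|exact: (is_dirP dii)].
  have := is_dirM (is_dir_cst v a w) (is_dirD h1 (is_dirM (is_dir_cst v b w) h2)).
  by rewrite !mul0r !add0r.
have zE : wirt_z f = fun w => 2^-1 * (dir_derive 1 f w + (- 'i%C) * dir_derive
  'i%C f w).
  by apply/funext => z; rewrite /wirt_z mulNr.
have e := dir_deriveC oU Uw (Cf 2%N).
rewrite {1}/wirt_z {2}/wirt_zbar zE /wirt_zbar.
rewrite !(D 1 _ _ (or_introl erefl)) !(D 'i%C _ _ (or_intror erefl)) e.
move: (dir_derive 1 (dir_derive 1 f) w) (dir_derive 1 (dir_derive 'i%C f) w)
  (dir_derive 'i%C (dir_derive 'i%C f) w) => a b a'.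
ring.
Qed.

End Rules.
End Wirtinger.

(** * Matrices of smooth functions on a chart *)

Section SmoothDerivations.
Context {R : realType} {M : riemannSurface R} {c : chart M}.
Local Notation C := (R[i]).
Local Notation U := (chart_img c).
Local Notation S := (smooth_fun c).
Implicit Types f g : S.
Let oU : open U := @chart_img_open R M c.

Lemma smooth_addE f g w : U w -> (f + g) w = f w + g w.
Proof. exact: mk_smoothE. Qed.

Lemma smooth_mulE f g w : U w -> (f * g) w = f w * g w.
Proof. exact: mk_smoothE. Qed.

Lemma smooth_oneE w : U w -> (1 : S) w = 1.
Proof. exact: mk_smoothE. Qed.

Lemma smooth_zeroE w : U w -> (0 : S) w = 0.
Proof. exact: mk_smoothE. Qed.

Lemma smooth_oppE f w : U w -> (- f) w = - f w.
Proof. by move=> Uw; rewrite mk_smoothE // mk_smoothE // mulN1r. Qed.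

Lemma smooth_sumE n (F : 'I_n -> S) w : U w -> (\sum_i F i) w = \sum_i F i w.
Proof.
move=> Uw; apply: (big_morph (fun f : S => f w)); last exact: smooth_zeroE.
by move=> f g; exact: smooth_addE.
Qed.

Definition smooth_d f : S := mk_smooth (Ck_wirt oU (smooth_valP f)).1.

Definition smooth_db f : S := mk_smooth (Ck_wirt oU (smooth_valP f)).2.

Definition smooth_conj f : S := mk_smooth (fun k => Ck_conj oU (smooth_valP f k)).

Lemma smooth_dE f w : U w -> smooth_d f w = wirt_z f w.
Proof. exact: mk_smoothE. Qed.

Lemma smooth_dbE f w : U w -> smooth_db f w = wirt_zbar f w.
Proof. exact: mk_smoothE. Qed.

Lemma smooth_conjE f w : U w -> smooth_conj f w = (f w)^*%C.
Proof. exact: mk_smoothE. Qed.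

Lemma smooth_dD f g : smooth_d (f + g) = smooth_d f + smooth_d g /\
  smooth_db (f + g) = smooth_db f + smooth_db g.
Proof.
split; apply: smooth_ext => w Uw; rewrite smooth_addE //.
- rewrite !smooth_dE // -(wirtD Uw (smooth_valP f) (smooth_valP g)).1.
  exact: (wirt_local oU Uw (fun z Uz => smooth_addE f g Uz)).1.
- rewrite !smooth_dbE // -(wirtD Uw (smooth_valP f) (smooth_valP g)).2.
  exact: (wirt_local oU Uw (fun z Uz => smooth_addE f g Uz)).2.
Qed.

Lemma smooth_dM f g : smooth_d (f * g) = smooth_d f * g + f * smooth_d g /\
  smooth_db (f * g) = smooth_db f * g + f * smooth_db g.
Proof.
split; apply: smooth_ext => w Uw; rewrite smooth_addE // !smooth_mulE //.
- rewrite !smooth_dE // -(wirtM Uw (smooth_valP f) (smooth_valP g)).1.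
  exact: (wirt_local oU Uw (fun z Uz => smooth_mulE f g Uz)).1.
- rewrite !smooth_dbE // -(wirtM Uw (smooth_valP f) (smooth_valP g)).2.
  exact: (wirt_local oU Uw (fun z Uz => smooth_mulE f g Uz)).2.
Qed.

Lemma smooth_conjD f g : smooth_conj (f + g) = smooth_conj f + smooth_conj g.
Proof.
apply: smooth_ext => w Uw.
by rewrite smooth_addE // !smooth_conjE // smooth_addE // rmorphD.
Qed.

Lemma smooth_conjM f g : smooth_conj (f * g) = smooth_conj f * smooth_conj g.
Proof.
apply: smooth_ext => w Uw.
by rewrite smooth_mulE // !smooth_conjE // smooth_mulE // rmorphM.
Qed.

Lemma smooth_conjK f : smooth_conj (smooth_conj f) = f.
Proof. by apply: smooth_ext => w Uw; rewrite !smooth_conjE // conjcK. Qed.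

Lemma smooth_conj_d f : smooth_conj (smooth_d f) = smooth_db (smooth_conj f).
Proof.
apply: smooth_ext => w Uw; rewrite smooth_conjE // smooth_dE // smooth_dbE //.
rewrite (wirt_conj Uw (smooth_valP f)); symmetry.
exact: (wirt_local oU Uw (fun z Uz => smooth_conjE f Uz)).2.
Qed.

Lemma smooth_d_db f : smooth_d (smooth_db f) = smooth_db (smooth_d f).
Proof.
apply: smooth_ext => w Uw; rewrite smooth_dE // smooth_dbE //.
rewrite (wirt_local oU Uw (fun z Uz => smooth_dbE f Uz)).1.
rewrite (wirt_local oU Uw (fun z Uz => smooth_dE f Uz)).2.
exact: wirt_comm oU Uw (smooth_valP f).
Qed.

Fact additive_of_D (F : S -> S) : {morph F : x y / x + y} -> zmod_morphism F.
Proof.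
move=> FD x y; have FB z : F (- z) = - F z.
  have F0 : F 0 = 0 by apply: (addrI (F 0)); rewrite -FD !addr0.
  by apply/eqP; rewrite -addr_eq0 -FD addNr F0.
by rewrite FD FB.
Qed.

HB.instance Definition _ := GRing.isZmodMorphism.Build S S smooth_d
  (additive_of_D (fun f g => (smooth_dD f g).1)).
HB.instance Definition _ := GRing.isZmodMorphism.Build S S smooth_db
  (additive_of_D (fun f g => (smooth_dD f g).2)).
HB.instance Definition _ := GRing.isZmodMorphism.Build S S smooth_conj
  (additive_of_D smooth_conjD).

Context {n : nat}.
Local Notation B := 'M[S]_n.

Definition mx_adj (X : B) : B := map_mx smooth_conj X^T.

Fact mx_adj_zmod : zmod_morphism mx_adj.
Proof. by move=> X Y; rewrite /mx_adj !raddfB. Qed.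

HB.instance Definition _ := GRing.isZmodMorphism.Build B B mx_adj mx_adj_zmod.

Local Notation d := (map_mx smooth_d : {additive B -> B}).
Local Notation db := (map_mx smooth_db : {additive B -> B}).

Lemma mx_dM (X Y : B) : d (X * Y) = d X * Y + X * d Y.
Proof.
apply/matrixP => i j; rewrite !mxE raddf_sum -big_split /=.
by apply: eq_bigr => k _; rewrite (smooth_dM _ _).1 !mxE.
Qed.

Lemma mx_dbM (X Y : B) : db (X * Y) = db X * Y + X * db Y.
Proof.
apply/matrixP => i j; rewrite !mxE raddf_sum -big_split /=.
by apply: eq_bigr => k _; rewrite (smooth_dM _ _).2 !mxE.
Qed.

Lemma mx_adjM (X Y : B) : mx_adj (X * Y) = mx_adj Y * mx_adj X.
Proof.
apply/matrixP => i j; rewrite !mxE raddf_sum /=.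
by apply: eq_bigr => k _; rewrite smooth_conjM mulrC !mxE.
Qed.

Lemma mx_adjK (X : B) : mx_adj (mx_adj X) = X.
Proof. by apply/matrixP => i j; rewrite !mxE smooth_conjK. Qed.

Lemma mx_adj_d (X : B) : mx_adj (d X) = db (mx_adj X).
Proof. by apply/matrixP => i j; rewrite !mxE smooth_conj_d. Qed.

Lemma mx_d_db (X : B) : d (db X) = db (d X).
Proof. by apply/matrixP => i j; rewrite !mxE; exact: smooth_d_db. Qed.

Lemma mx_torsion_free (X : B) : X + X = 0 -> X = 0.
Proof.
move=> /matrixP h; apply/matrixP => i j; apply: smooth_ext => w Uw.
have := congr1 (fun f : S => f w) (h i j).
rewrite !mxE smooth_addE // smooth_zeroE // -mulr2n => /eqP.
by rewrite mulrn_eq0 /= => /eqP.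
Qed.

Definition ev (w : C) (X : B) : 'M[C]_n := map_mx (fun f : S => f w) X.

Lemma evD w X Y : U w -> ev w (X + Y) = ev w X + ev w Y.
Proof. by move=> Uw; apply/matrixP => i j; rewrite !mxE smooth_addE. Qed.

Lemma evN w X : U w -> ev w (- X) = - ev w X.
Proof. by move=> Uw; apply/matrixP => i j; rewrite !mxE smooth_oppE. Qed.

Lemma ev0 w : U w -> ev w 0 = 0.
Proof. by move=> Uw; apply/matrixP => i j; rewrite !mxE smooth_zeroE. Qed.

Lemma ev1 w : U w -> ev w 1 = 1.
Proof.
move=> Uw; apply/matrixP => i j; rewrite !mxE.
by case: (i == j); rewrite ?smooth_oneE ?smooth_zeroE.
Qed.

Lemma evM w X Y : U w -> ev w (X * Y) = ev w X * ev w Y.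
Proof.
move=> Uw; apply/matrixP => i j; rewrite !mxE smooth_sumE //.
by apply: eq_bigr => k _; rewrite smooth_mulE // !mxE.
Qed.

Lemma evX w X k : U w -> ev w (X ^+ k) = ev w X ^+ k.
Proof.
by move=> Uw; elim: k => [|k IH]; rewrite ?expr0 ?ev1 // !exprS evM // IH.
Qed.

Lemma ev_ext X Y : (forall w, U w -> ev w X = ev w Y) -> X = Y.
Proof.
move=> h; apply/matrixP => i j; apply: smooth_ext => w Uw.
by have /matrixP/(_ i j) := h w Uw; rewrite !mxE.
Qed.

End SmoothDerivations.

(** * Evaluation at points and filled-out images *)

Section Representation.
Context {R : realType} {M : riemannSurface R} {c : chart M} {n : nat}.
Local Notation C := (R[i]).
Local Notation U := (chart_img c).
Local Notation B := 'M[smooth_fun c]_n.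
Local Notation d := (map_mx (@smooth_d R M c) : {additive B -> B}).
Local Notation db := (map_mx (@smooth_db R M c) : {additive B -> B}).
Let oU : open U := @chart_img_open R M c.

(** By continuity: a nonzero value of an entry would persist nearby, and the plane has no isolated
    points. All filling out of zeros rests on this. *)
Lemma ev_isolated (X : B) w : U w ->
  (\forall q \near (param c w)^', chart_dom c q -> ev (Defs.coord c q) X = 0) ->
  ev w X = 0.
Proof.
move=> Uw near0; apply/matrixP => i j; rewrite !mxE.
apply/eqP; apply: contraT => ne; set f := X i j in ne.
have [cf _] := smooth_valP f 0%N.
have nf : nbhs (w : C^o) [set z | `|f w - f z| < `|f w|].
  have := cf w Uw; move=> /cvgrPdist_lt; apply; by rewrite normr_gt0.
have nU : nbhs (w : C^o) U by exact: open_nbhs_nbhs.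
have np : nbhs (w : C^o) [set z | param c z != param c w ->
    chart_dom c (param c z) -> ev (Defs.coord c (param c z)) X = 0].
  exact: (param_continuous Uw near0).
have [z [zw [zf [zU zp]]]] : exists z, z != w /\ (`|f w - f z| < `|f w| /\ (U z /\
    (param c z != param c w -> chart_dom c (param c z) -> ev (Defs.coord c (param
      c z)) X = 0))).
  have : nbhs (w : C^o)^' [set z | z != w /\ (`|f w - f z| < `|f w| /\ (U z /\
    (param c z != param c w -> chart_dom c (param c z) -> ev (Defs.coord c (param
      c z)) X = 0)))].
    apply: filterS (filterI nf (filterI nU np)) => z [? [? ?]] zw; split; first
      exact: zw.
    by split=> //; split.
  by move=> /(@filter_ex _ _ (@Proper_dnbhs_numFieldType C w)).
have pz : param c z != param c w.
  by apply: contra zw => /eqP e; rewrite -(paramK zU) e paramK.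
have := zp pz (param_dom zU); rewrite paramK // => /matrixP/(_ i j); rewrite !mxE.
by move=> fz; move: zf; rewrite /f fz subr0 ltxx.
Qed.

Definition represents (X : B) (F : M -> 'M[C]_n) :=
  forall w, U w -> ev w X = F (param c w).

Definition lift_mx (F : M -> 'M[C]_n) (sF : smooth_on c F) : B :=
  \matrix_(i, j) mk_smooth (sF i j).

Lemma lift_mxP (F : M -> 'M[C]_n) (sF : smooth_on c F) : represents (lift_mx sF) F.
Proof. by move=> w Uw; apply/matrixP => i j; rewrite !mxE mk_smoothE. Qed.

Lemma represents_entry X F i j z : represents X F -> U z -> X i j z = F (param c
  z) i j.
Proof. by move=> XF Uz; have /matrixP/(_ i j) := XF z Uz; rewrite !mxE. Qed.

Lemma ev_d X F w : represents X F -> U w -> ev w (d X) = d_z c F (param c w).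
Proof.
move=> XF Uw; apply/matrixP => i j; rewrite !mxE smooth_dE // paramK //.
exact: (wirt_local oU Uw (fun z Uz => represents_entry i j XF Uz)).1.
Qed.

Lemma ev_db X F w : represents X F -> U w -> ev w (db X) = d_zbar c F (param c w).
Proof.
move=> XF Uw; apply/matrixP => i j; rewrite !mxE smooth_dbE // paramK //.
exact: (wirt_local oU Uw (fun z Uz => represents_entry i j XF Uz)).2.
Qed.

Lemma ev_adj (X : B) w : U w -> ev w (mx_adj X) = (ev w X)^t*.
Proof. by move=> Uw; apply/matrixP => i j; rewrite !mxE smooth_conjE. Qed.

Lemma evB (X Y : B) w : U w -> ev w (X - Y) = ev w X - ev w Y.
Proof. by move=> Uw; rewrite evD // evN. Qed.

Lemma ev_sum m (X : 'I_m -> B) w : U w -> ev w (\sum_i X i : B) = \sum_i ev w (X i).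
Proof.
move=> Uw; apply: (big_morph (fun X : B => ev w X)); last by rewrite ev0.
by move=> Y Z; exact: evD.
Qed.

Lemma projector_lift X F : represents X F -> (forall p, orthoprojector (F p)) ->
  @projector B (@mx_adj R M c n : {additive B -> B}) X.
Proof.
move=> XF oF; split; apply: ev_ext => w Uw; rewrite ?evM // ?ev_adj // XF //.
  by case: (oF (param c w)).
by case: (oF (param c w)).
Qed.

Lemma represents_perp X F : represents X F -> represents (1 - X) (perp F).
Proof. by move=> XF w Uw; rewrite evB // ev1 // XF. Qed.

Lemma ev_sff X Y F H w : represents X F -> represents Y H -> U w ->
  ev w (Y * d X * X) = sff F H c (param c w).
Proof. by move=> XF YH Uw; rewrite !evM // (ev_d XF) // XF // YH. Qed.

(** Off isolated points both matrices have the same column space, so they are annihilated by the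
    same left factors; [ev_isolated] covers the other points. Column spaces are row spaces of
    transposes. *)
Lemma fills_lift X Y F H : represents X F -> represents Y H ->
  (forall p, orthoprojector (F p)) -> filled_image (sff_perp F) H ->
  @fills B (@mx_adj R M c n : {additive B -> B}) (d X * X) Y.
Proof.
move=> XF YH oF [[sH oH] fill].
have pX := projector_lift XF oF; have pY := projector_lift YH oH.
have NE : d X * X = (1 - X) * d X * X.
  have [_ XX] := pX; rewrite -idem_d //; last exact: mx_dM.
  by rewrite -mulrA XX.
have evN' q : chart_dom c q -> ev (Defs.coord c q) (d X * X) = sff_perp F c q.
  move=> cq; have Uq := coord_img cq.
  by rewrite NE (ev_sff XF (represents_perp XF)) // coordK.
have evY q : chart_dom c q -> ev (Defs.coord c q) Y = H q.
  by move=> cq; rewrite YH ?coordK //; exact: coord_img.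
split=> //.
- apply/eqP; rewrite -subr_eq0; apply/eqP; apply: ev_ext => w Uw; rewrite ev0 //.
  apply: ev_isolated => //; apply: filterS (fill (param c w)) => q hq cq.
  have Uq := coord_img cq; rewrite evB // (evM Y) // evY // evN' //.
  have /submxP[D e] : ((sff_perp F c q)^T <= (H q)^T)%MS by rewrite hq.
  have -> : sff_perp F c q = H q *m D^T by rewrite -[LHS]trmxK e trmx_mul trmxK.
  by have [_ HH] := oH q; rewrite -mulmxE mulmxA HH subrr.
- move=> Z ZN; apply: ev_ext => w Uw; rewrite ev0 //.
  apply: ev_isolated => //; apply: filterS (fill (param c w)) => q hq cq.
  have Uq := coord_img cq; rewrite (evM Z) // evY //.
  have /submxP[D e] : ((H q)^T <= (sff_perp F c q)^T)%MS by rewrite hq.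
  have -> : H q = sff_perp F c q *m D^T by rewrite -[LHS]trmxK e trmx_mul trmxK.
  by rewrite -evN' // -mulmxE mulmxA mulmxE -(evM Z) // ZN ev0 // mul0r.
Qed.

End Representation.

(** * Unitons on a chart *)

Section Unitons.
Context {R : realType} {M : riemannSurface R} {c : chart M} {n : nat}.
Local Notation C := (R[i]).
Local Notation U := (chart_img c).
Local Notation B := 'M[smooth_fun c]_n.
Local Notation d := (map_mx (@smooth_d R M c) : {additive B -> B}).
Local Notation db := (map_mx (@smooth_db R M c) : {additive B -> B}).
Local Notation st := (@mx_adj R M c n : {additive B -> B}).

Definition half_mx (X : B) : B := map_mx (fun f => smooth_cst 2^-1 * f) X.

Lemma half_mxD X : half_mx X + half_mx X = X.
Proof.
apply/matrixP => i j; apply: smooth_ext => w Uw; rewrite !mxE smooth_addE //.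
have e : 1 = 2^-1 + 2^-1 :> C by rewrite {1}(splitr 1) mul1r.
by rewrite smooth_mulE // mk_smoothE // -mulrDl -e mul1r.
Qed.

Lemma ev_half_mx X w : U w -> ev w (half_mx X) = 2^-1 *: ev w X.
Proof.
by move=> Uw; apply/matrixP => i j; rewrite !mxE smooth_mulE // mk_smoothE.
Qed.

Lemma ev_A_z X (F : M -> 'M[C]_n) w : represents X F -> F (param c w) \is unitarymx ->
  U w -> ev w (half_mx (st X * d X)) = A_z F c (param c w).
Proof.
move=> XF uF Uw; rewrite (ev_half_mx _ Uw) (evM _ _ Uw) (ev_adj _ Uw) (ev_d XF
  Uw) (XF w Uw).
by rewrite /A_z (invmx_unitary uF).
Qed.

Lemma ev_A_zbar X (F : M -> 'M[C]_n) w : represents X F -> F (param c w) \is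
  unitarymx ->
  U w -> ev w (half_mx (st X * db X)) = A_zbar F c (param c w).
Proof.
move=> XF uF Uw; rewrite (ev_half_mx _ Uw) (evM _ _ Uw) (ev_adj _ Uw) (ev_db XF
  Uw) (XF w Uw).
by rewrite /A_zbar (invmx_unitary uF).
Qed.

Lemma col_mulmx m p q (A : 'M[C]_(m, p)) (K : 'M[C]_(p, q)) j :
  col j (A *m K) = A *m col j K.
Proof. by rewrite !colE mulmxA. Qed.

Lemma d_zbar_col (F : M -> 'M[C]_n) j p :
  d_zbar c (fun q => col j (F q)) p = col j (d_zbar c F p).
Proof.
apply/matrixP => i k; rewrite mxE [RHS]mxE [RHS]mxE.
suff -> : (fun w => col j (F (param c w)) i k) = (fun w => F (param c w) i j) by [].
by apply/funext => w; rewrite mxE.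
Qed.

Lemma col_smooth (F : M -> 'M[C]_n) j : smooth_on c F ->
  smooth_on c (fun q => col j (F q)).
Proof.
move=> sF i k m; have oU : open (U : set C^o) := @chart_img_open R M c.
by apply: Ck_local oU _ (sF i j m) => w _; rewrite mxE.
Qed.

(** The columns of the projection onto [al] are sections of [al], and applying the closure
    conditions to all of them gives matrix identities. *)
Lemma uniton_lift (psi al : M -> 'M[C]_n) X Y : uniton psi al ->
  represents X psi -> represents Y al ->
  [/\ projector (st := st) Y, (1 - Y) * (db Y + half_mx (st X * db X) * Y) = 0 &
      (1 - Y) * (half_mx (st X * d X) * Y) = 0].
Proof.
move=> [[_ upsi _] [sal oal] closed] Xpsi Yal.
have col_closed (K : M -> 'M[C]_n) p :
    (forall j, al p *m col j (K p) = col j (K p)) -> al p *m K p = K p.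
  move=> h; apply/matrixP => i j.
  by have /matrixP/(_ i 0) := h j; rewrite -col_mulmx !mxE.
have sec j p : al p *m col j (al p) = col j (al p).
  by rewrite -col_mulmx; have [_ ->] := oal p.
have cl j := closed c _ (col_smooth j (sal c)) (fun p _ => sec j p).
have compl Z w : U w -> al (param c w) *m ev w Z = ev w Z -> ev w ((1 - Y) * Z) = 0.
  by move=> Uw e; rewrite evM // evB // ev1 // mulrBl mul1r Yal // -mulmxE e subrr.
split; first exact: projector_lift Yal oal.
- apply: ev_ext => w Uw; rewrite ev0 //; apply: compl => //.
  rewrite (evD _ _ Uw) (ev_db Yal Uw) (evM _ _ Uw) (ev_A_zbar Xpsi (upsi _) Uw)
    (Yal _ Uw).
  apply: (col_closed (fun p => d_zbar c al p + A_zbar psi c p * al p)) => j.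
  have [+ _] := cl j _ (param_dom Uw).
  by rewrite d_zbar_col -mulmxE -col_mulmx -raddfD.
- apply: ev_ext => w Uw; rewrite ev0 //; apply: compl => //.
  rewrite (evM _ _ Uw) (ev_A_z Xpsi (upsi _) Uw) (Yal _ Uw).
  apply: (col_closed (fun p => A_z psi c p * al p)) => j.
  have [_ +] := cl j _ (param_dom Uw).
  by rewrite -mulmxE -col_mulmx.
Qed.

Lemma uniton_product_lift phi0 (al : nat -> M -> 'M[C]_n) s :
  phi0 \is unitarymx ->
  (forall i, (i < s)%N -> uniton (uniton_product phi0 al i) (al i)) ->
  exists X A : B, [/\ represents X (uniton_product phi0 al s), st X * X = 1,
    A + A = st X * d X & array_bound (d := d) A s].
Proof.
move=> u0; elim: s => [|s IH] un.
  pose X : B := \matrix_(i, j) smooth_cst (phi0 i j).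
  have XE w : U w -> ev w X = phi0.
    by move=> Uw; apply/matrixP => i j; rewrite !mxE mk_smoothE.
  have dX : d X = 0.
    apply: ev_ext => w Uw; rewrite ev0 //.
    rewrite (@ev_d _ _ _ _ _ (fun=> phi0)) //; apply/matrixP => i j; rewrite !mxE.
    rewrite /wirt_z !(is_dirE (is_dir_cst _ _ _)).
    by rewrite mulr0 subr0 mulr0.
  exists X, 0; split=> //; last exact: array_bound0.
    apply: ev_ext => w Uw; rewrite evM // ev_adj // XE // ev1 //.
    by rewrite -invmx_unitary // -mulmxE mulVmx // unitarymx_unit.
  by rewrite dX mulr0 addr0.
have [X [A [XE X1 hA bA]]] := IH (fun i si => un i (ltnW si)).
have usa := un s (ltnSn s); have [hpsi [sal oal] _] := usa.
pose Y := lift_mx (sal c); have YE := lift_mxP (sal c).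
have [pY cl1 cl2] := uniton_lift usa XE YE; have [sY YY] := pY.
pose X' := X * (Y - (1 - Y)).
have hAE : half_mx (st X * d X) = A.
  by apply: (double_inj (@mx_torsion_free _ _ _ _)); rewrite half_mxD hA.
exists X', (half_mx (st X' * d X')); split.
- by move=> w Uw; rewrite /X' evM // !evB // ev1 // XE // YE.
- have stq : st (Y - (1 - Y)) = Y - (1 - Y).
    by rewrite !(raddfB st) sY (adjoint1 (@mx_adjM _ _ _ _) (@mx_adjK _ _ _ _)).
  have -> : st X' = (Y - (1 - Y)) * st X by rewrite -[in RHS]stq; exact: mx_adjM.
  have -> : (Y - (1 - Y)) * st X * X' = (Y - (1 - Y)) * (st X * X) * (Y - (1 - Y)).
    by rewrite !mulrA.
  by rewrite X1 mulr1 idem_reflection.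
- exact: half_mxD.
- apply: (uniton_bound (st := st) (db := db) (@mx_dM _ _ _ _) (@mx_dbM _ _ _ _)
    (@mx_adjM _ _ _ _) (@mx_adjK _ _ _ _) (@mx_adj_d _ _ _ _)
    (@mx_torsion_free _ _ _ _) X1 pY hA (half_mxD _) (half_mxD _) cl1 _ bA).
  by rewrite -hAE.
Qed.

Lemma cartan_lift (phi : M -> 'M[C]_n) P : (forall p, orthoprojector (phi p)) ->
  represents P phi -> harmonic_U (cartan phi) ->
  P * db (d P) = db (d P) * P /\
  (finite_uniton_number (cartan phi) ->
    exists s, array_bound (d := d) ((P - (1 - P)) * d P) s).
Proof.
move=> ophi Pphi [_ uq hq].
have pP := projector_lift Pphi ophi; have [sP PP] := pP.
set Q := P - (1 - P).
have Qphi : represents Q (cartan phi).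
  by move=> w Uw; rewrite /Q !evB // ev1 // Pphi.
have stQ : st Q = Q.
  by rewrite !(raddfB st) sP (adjoint1 (@mx_adjM _ _ _ _) (@mx_adjK _ _ _ _)).
have dQ : d Q = d P + d P.
  by rewrite !(raddfB d) (derivation1 (@mx_dM _ _ _ _)) sub0r opprK.
have dbQ : db Q = db P + db P.
  by rewrite !(raddfB db) (derivation1 (@mx_dbM _ _ _ _)) sub0r opprK.
have tf := @mx_torsion_free _ M c n.
have Az : half_mx (st Q * d Q) = Q * d P.
  by apply: (double_inj tf); rewrite half_mxD stQ dQ mulrDr.
have Azb : half_mx (st Q * db Q) = Q * db P.
  by apply: (double_inj tf); rewrite half_mxD stQ dbQ mulrDr.
split=> [|[s [phi0 [al [u0 un pe]]]]].
  apply: (harmonic_commute (@mx_dM _ _ _ _) (@mx_dbM _ _ _ _) (@mx_d_db _ _ _ _)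
    tf PP).
  apply: ev_ext => w Uw; rewrite ev0 // evD //.
  rewrite -/Q -Az -Azb (@ev_db _ _ _ _ _ (A_z (cartan phi) c)) //; last first.
    by move=> z Uz; rewrite (ev_A_z Qphi).
  rewrite (@ev_d _ _ _ _ _ (A_zbar (cartan phi) c)) //; last first.
    by move=> z Uz; rewrite (ev_A_zbar Qphi).
  by rewrite hq //; exact: param_dom.
have [X [A [XE X1 hA bA]]] := uniton_product_lift u0 un.
exists s; have QX : X = Q.
  by apply: ev_ext => w Uw; rewrite XE // Qphi // pe.
rewrite QX in hA.
have AQ : A = half_mx (st Q * d Q).
  by apply: (double_inj tf); rewrite half_mxD; exact: hA.
by rewrite -Az -AQ.
Qed.

End Unitons.

(** * The return maps *)

Section RankOne.
Context {F : fieldType} {n : nat}.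
Implicit Types m h P : 'M[F]_n.

(** A rank-one [m] is a column u times a row v, so [m * h * m] is the scalar v h u times [m], and
    [(m * h) ^+ q * m] is the [q]-th power of that scalar times [m]. *)
Lemma rank_le1_nilpotent m h q :
  (\rank m <= 1)%N -> (m * h) ^+ q * m = 0 -> m * h * m = 0.
Proof.
rewrite -!mulmxE; move: (col_base m) (row_base m) (mulmx_base m).
case: (\rank m) => [|[|//]] u v <- _; first by rewrite (thinmx0 u) mul0mx !mulmx0.
set a := v *m h *m u.
have step : u *m v *m h *m (u *m v) = a 0 0 *: (u *m v).
  have -> : u *m v *m h *m (u *m v) = u *m a *m v by rewrite /a !mulmxA.
  by rewrite [in LHS](mx11_scalar a) mul_mx_scalar -scalemxAl.
have pow : (u *m v *m h) ^+ q *m (u *m v) = a 0 0 ^+ q *: (u *m v).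
  elim: q => [|q IH]; first by rewrite expr0 expr0 scale1r mul1mx.
  by rewrite exprSr -mulmxE -mulmxA step -scalemxAr IH scalerA -exprS.
rewrite pow step => /eqP; rewrite scaler_eq0 => /orP[|/eqP ->]; last by rewrite
  scaler0.
by rewrite expf_eq0 => /andP[_ /eqP ->]; rewrite scale0r.
Qed.

(* Frobenius' inequality, applied to c c c and to c P c. *)
Lemma rank_sq_le1 m P : P * m = m -> m * P = m -> (\rank P <= 5)%N ->
  m ^+ 3 = 0 -> (\rank (m ^+ 2)%R <= 1)%N.
Proof.
move=> Pm mP rP m3; have := mxrank_Frobenius m P m; have := mxrank_Frobenius m m m.
have -> : m *m m = m ^+ 2 by rewrite expr2.
have -> : m ^+ 2 *m m = 0 by rewrite mulmxE -exprSr.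
(* With a and b the ranks of [m] and [m ^+ 2], the two inequalities give 2b <= a and 2a <= b + 5,
   hence 3b <= 5. *)
rewrite !mulmxE mP Pm -expr2 mxrank0; lia.
Qed.

End RankOne.

(** * Vanishing of the return cycle *)

Section ReturnMaps.
Context {R : realType} {M : riemannSurface R} {c : chart M} {n : nat}.
Local Notation C := (R[i]).
Local Notation U := (chart_img c).
Local Notation B := 'M[smooth_fun c]_n.
Local Notation d := (map_mx (@smooth_d R M c) : {additive B -> B}).
Context {G : nat -> M -> 'M[C]_n} {X : nat -> B} {r : nat}.
Context (XG : forall i, represents (X i) (G i)).

Lemma ev_chain i w : U w -> ev w (@chain B d X i) = sff_chain G i c (param c w).
Proof.
move=> Uw; elim: i => [|i IH]; first exact: XG.
rewrite /= evM // IH; congr (_ *m _).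
exact: ev_sff (XG i) (represents_perp (XG i)) Uw.
Qed.

Lemma ev_return1 w : U w -> ev w (@return1 B d X r) = first_return G r c (param c w).
Proof.
move=> Uw; rewrite /return1 evM // ev_chain //; congr (_ *m _).
exact: ev_sff (XG r) (XG 0%N) Uw.
Qed.

Lemma represents_remainder : represents (1 - \sum_(i < r.+1) X i) (remainder G r).
Proof.
move=> w Uw; rewrite evB // ev1 // ev_sum //; congr (_ - _).
by apply: eq_bigr => i _; rewrite XG.
Qed.

Lemma ev_return2 w : U w -> ev w (@return2 B d X r) = second_return G r c (param c w).
Proof.
move=> Uw; rewrite /return2 evM // ev_chain //; congr (_ *m _).
rewrite evM //; congr (_ *m _).
  exact: ev_sff represents_remainder (XG 0%N) Uw.
exact: ev_sff (XG r) represents_remainder Uw.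
Qed.

End ReturnMaps.

Lemma ev_rank_le1_nilpotent (R : realType) (M : riemannSurface R) (c : chart M)
    (n q : nat) (X Y : 'M[smooth_fun c]_n) w : chart_img c w ->
  (\rank (ev w X) <= 1)%N -> (X * Y) ^+ q * X = 0 -> ev w (X * Y * X) = 0.
Proof.
move=> Uw rX /(congr1 (ev w)); rewrite ev0 // evM // evX // evM // => XY.
by rewrite evM // evM // (rank_le1_nilpotent rX XY).
Qed.

(** The vanishing is stated on the image of c^2 itself, and through a matrix of smooth functions, so
    that continuity can carry it over to the filled-out image. *)
Lemma return_cycle_on_chart (R : realType) (M : riemannSurface R) (n : nat)
    (phi : M -> 'M[R[i]]_n) (G : nat -> M -> 'M[R[i]]_n) (r : nat) (c : chart M) :
  harmonic_Gr 5 phi -> finite_uniton_number (cartan phi) ->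
  gauss_sequence phi G -> isotropy_order G r -> nilorder (first_return G r) 3 ->
  exists X : 'M[smooth_fun c]_n,
    represents X (fun p => first_return G r c p ^+ 2 *m second_return G r c p *m
      first_return G r c p *m second_return G r c p) /\
    forall w, chart_img c w -> ev w X *m first_return G r c (param c w) ^+ 2 = 0.
Proof.
move=> [sphi gphi hU] fu [G0 fill] [r1 iso _] [c3 _].
have sG i : smooth (G i) by case: i => [|i]; [rewrite G0|case: (fill i) => -[]].
have oG i p : orthoprojector (G i p).
  by case: i => [|i]; [rewrite G0; case: (gphi p)|case: (fill i) => -[]].
pose X i := lift_mx (sG i c); have XG i : represents (X i) (G i) by exact: lift_mxP.
have Xproj i := projector_lift (XG i) (oG i).
have Xfill i := fills_lift (XG i) (XG i.+1) (oG i) (fill i).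
have Xorth i : (0 < i <= r)%N -> X i * X 0%N = 0.
  by move=> ir; apply: ev_ext => w Uw; rewrite evM // ev0 // !XG //; exact: iso.
have hcart : harmonic_U (cartan (G 0%N)) by rewrite G0.
have [XL /(_ _)[|s Xs]] := cartan_lift (oG 0%N) (XG 0%N) hcart; first by rewrite G0.
pose c1 := @return1 'M[smooth_fun c]_n (map_mx (@smooth_d R M c)) X r.
pose e1 := @return2 'M[smooth_fun c]_n (map_mx (@smooth_d R M c)) X r.
have Ec w : chart_img c w -> ev w c1 = first_return G r c (param c w).
  exact: (@ev_return1 _ _ _ _ _ _ r XG w).
have Ee w : chart_img c w -> ev w e1 = second_return G r c (param c w).
  exact: (@ev_return2 _ _ _ _ _ _ r XG w).
have c13 : c1 ^+ 3 = 0.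
  by apply: ev_ext => w Uw; rewrite evX // Ec // ev0 // c3 //; exact: param_dom.
have rk w : chart_img c w -> (\rank (ev w (c1 ^+ 2)) <= 1)%N.
  move=> Uw; rewrite evX //; have [_ GG] := oG 0%N (param c w).
  apply: (@rank_sq_le1 _ _ _ (G 0%N (param c w))).
  - by rewrite Ec // /first_return /sff -!mulmxE !mulmxA GG.
  - rewrite Ec // /first_return -mulmxE -mulmxA; congr (_ *m _).
    suff : forall i, sff_chain G i c (param c w) *m G 0%N (param c w) =
      sff_chain G i c (param c w) by apply.
    by elim=> [//|i IH] /=; rewrite -mulmxA IH.
  - by rewrite G0; case: (gphi (param c w)) => _ ->.
  - by rewrite -evX // c13 ev0.
have nil1 : exists q, (c1 ^+ 2 * e1) ^+ q * c1 ^+ 2 = 0.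
  exact: (return_cycle1 (@mx_dM R M c n) (@mx_dbM R M c n) (@mx_adjM R M c n)
    (@mx_adjK R M c n) (@mx_adj_d R M c n) (@mx_d_db R M c n) r1 Xproj XL Xfill
    Xorth Xs c13).
have nil2 : c1 ^+ 2 * e1 * c1 ^+ 2 = 0 ->
    exists q, (c1 ^+ 2 * e1 * c1 * e1) ^+ q * c1 ^+ 2 = 0.
  exact: (return_cycle2 (@mx_dM R M c n) (@mx_dbM R M c n) (@mx_adjM R M c n)
    (@mx_adjK R M c n) (@mx_adj_d R M c n) (@mx_d_db R M c n) r1 Xproj XL Xfill
    Xorth Xs c13).
clearbody c1 e1.
have [q] : exists q, (c1 ^+ 2 * e1 * c1 * e1) ^+ q * c1 ^+ 2 = 0.
  apply: nil2; have [q hq] := nil1; apply: ev_ext => w Uw; rewrite ev0 //.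
  exact: ev_rank_le1_nilpotent (rk w Uw) hq.
(* Bracketed as c^2 times e c e, so that the factor of rank at most one is isolated. *)
rewrite -!(mulrA (c1 ^+ 2)) => hq.
exists (c1 ^+ 2 * e1 * c1 * e1); split=> w Uw.
  by rewrite (evM (_ * c1)) // (evM (_ * e1)) // (evM (c1 ^+ 2)) // evX // Ec // Ee.
rewrite -Ec // -evX // mulmxE -evM // -!(mulrA (c1 ^+ 2)).
by rewrite mulrA; exact: ev_rank_le1_nilpotent (rk w Uw) hq.
Qed.

Theorem proposition2p26 (R : realType) (M : riemannSurface R) (n : nat)
    (phi : M -> 'M[R[i]]_n) (G : nat -> M -> 'M[R[i]]_n) (r : nat)
    (alpha : M -> 'M[R[i]]_n) :
  connected [set: M] ->
  harmonic_Gr 5 phi ->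
  finite_uniton_number (cartan phi) ->
  gauss_sequence phi G ->
  isotropy_order G r ->
  nilorder (first_return G r) 3 ->
  filled_image (fun c p => first_return G r c p ^+ 2) alpha ->
  nilpotent_map (return_cycle G r alpha) /\
  vanishes (return_cycle G r alpha).
Proof.
move=> _ hphi fu gauss iso c3 [[sal oal] im].
suff van : vanishes (return_cycle G r alpha).
  by split=> //; exists 1%N => c p cp; rewrite expr1 van.
move=> c p cp; have [X [XE Xc]] := return_cycle_on_chart c hphi fu gauss iso c3.
have Uw := coord_img cp; pose Y := lift_mx (sal c); have YE := lift_mxP (sal c).
(* [alpha] is known to be the image of c^2 only away from isolated points, hence the detour through
   nearby points. *)
suff : ev (Defs.coord c p) (X * Y) = 0.
  by rewrite evM // XE // YE // coordK.
apply: ev_isolated => //; apply: filterS (im (param c (Defs.coord c p))) => q hq cq.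
have Uq := coord_img cq; rewrite evM // YE // coordK //.
have /submxP[D e] : ((alpha q)^T <= (first_return G r c q ^+ 2)^T)%MS by rewrite hq.
have -> : alpha q = first_return G r c q ^+ 2 *m D^T by rewrite -[LHS]trmxK e
  trmx_mul trmxK.
by have := Xc _ Uq; rewrite coordK // -mulmxE mulmxA => ->; rewrite mul0mx.
Qed.
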